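(* Let $d\ge2$, let $(H,\mathbb Y,\mathbf 1)$ be a $d$-CC system and $Y(-,x):H\otimes H\to H((x_1,\dots,x_d,|x|^{\mathbb R}))$ the associated vertex operator. Then, for any $u_0\in H^\vee$ and $a_1,a_2,a_3\in H$, the sums $\sum_{\Delta\in\mathbb R}\langle u_0,Y(a_1,x^{(1)})\mathrm{pr}_\Delta Y(a_2,x^{(2)})a_3\rangle$ and $\sum_{\Delta\in\mathbb R}\langle u_0,Y(\mathrm{pr}_\Delta Y(a_1,x^{(0)})a_2,x^{(2)})a_3\rangle$ are absolutely convergent if $|x^{(1)}|>|x^{(2)}|>0$ and $|x^{(2)}|>|x^{(0)}|>0$, respectively. Moreover, there exists a real analytic function $\phi(x^{(1)},x^{(2)})$ on $Y_2(\mathbb R^d)=\{(x^{(1)},x^{(2)})\in(\mathbb R^d)^2: x^{(1)}\ne0,\ x^{(2)}\ne0,\ x^{(1)}\ne x^{(2)}\}$ with values in $\mathbb C$ such that: (1) the sums $\sum_{\Delta}\langle u_0,Y(a_1,x^{(1)})\mathrm{pr}_\Delta Y(a_2,x^{(2)})a_3\rangle$ and $\sum_{\Delta}\langle u_0,Y(a_2,x^{(2)})\mathrm{pr}_\Delta Y(a_1,x^{(1)})a_3\rangle$ are locally uniformly convergent to $\phi(x^{(1)},x^{(2)})$ in $|x^{(1)}|>|x^{(2)}|>0$ and $|x^{(2)}|>|x^{(1)}|>0$, respectively; (2) the sum $\sum_{\Delta}\langle u_0,Y(\mathrm{pr}_\Delta Y(a_1,x^{(0)})a_2,x^{(2)})a_3\rangle$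 with $x^{(0)}=x^{(1)}-x^{(2)}$ is locally uniformly convergent to $\phi(x^{(1)},x^{(2)})$ in $|x^{(2)}|>|x^{(1)}-x^{(2)}|>0$.
   Context: **Lie algebra.** Fix an integer $d\ge2$. $\mathfrak{so}(d+1,1)$ is the real Lie algebra with basis $D$, $P_\mu,K_\mu$ ($1\le\mu\le d$), $J_{\mu,\nu}$ ($1\le\mu<\nu\le d$), with $J_{\nu,\mu}=-J_{\mu,\nu}$ and brackets $[P_\mu,P_\nu]=[K_\mu,K_\nu]=0$, $[D,K_\mu]=-K_\mu$, $[D,P_\mu]=P_\mu$, $[D,J_{\mu,\nu}]=0$, $[P_\mu,K_\nu]=-2(\delta_{\mu,\nu}D+J_{\mu,\nu})$, $[J_{\mu,\nu},P_\rho]=-\delta_{\mu,\rho}P_\nu+\delta_{\nu,\rho}P_\mu$, $[J_{\mu,\nu},K_\rho]=-\delta_{\mu,\rho}K_\nu+\delta_{\nu,\rho}K_\mu$, $[J_{\mu,\nu},J_{\rho,\sigma}]=\delta_{\nu,\rho}J_{\mu,\sigma}-\delta_{\mu,\rho}J_{\nu,\sigma}-\delta_{\nu,\sigma}J_{\mu,\rho}+\delta_{\mu,\sigma}J_{\nu,\rho}$. For $X\in\mathfrak{so}(d+1,1)$ put $\tau_x(X)=\exp(-\sum_\rho x_\rho\,\mathrm{ad}P_\rho)X$ (a finite sum, polynomial in $x$). **Compact modules.** A (complex) $\mathfrak{so}(d+1,1)$-module $H$ is compact if (C1) $H=\bigoplus_{\Delta\in\mathbb R}H_\Delta$ with $H_\Delta=\{a: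 Da=\Delta a\}$; (C2) $\sum_{\Delta\le M}\dim H_\Delta<\infty$ for all $M\in\mathbb R$; (C3) the action of $\mathfrak{so}(d)=\langle J_{\mu,\nu}\rangle$ on each $H_\Delta$ exponentiates to $\mathrm{SO}(d)$. Put $\overline H=\prod_\Delta H_\Delta$ (with componentwise action), $H^\vee=\bigoplus_\Delta H_\Delta^*$, $\langle-,-\rangle$ the pairing of $H^\vee$ with $\overline H$, $\mathrm{pr}_\Delta:\overline H\to H_\Delta$ the projection. **$d$-CC systems.** $\mathrm{Conf}_n(\mathbb R^d)=\{(x^{(1)},\dots,x^{(n)})\in(\mathbb R^d)^n: x^{(i)}\ne x^{(j)}\text{ for }i\neq j\}$. For $n,m\ge1$, $U_{n,m}$ is the set of $((x^{(1)},\dots,x^{(n)},w),(y^{(1)},\dots,y^{(m)}))\in\mathrm{Conf}_{n+1}(\mathbb R^d)\times\mathrm{Conf}_m(\mathbb R^d)$ with $\min_k|x^{(k)}-w|>\max_l|y^{(l)}|$; $U_{0,m}=\mathrm{Conf}_1(\mathbb R^d)\times\mathrm{Conf}_m(\mathbb R^d)$. A $d$-CC system $(H,\mathbb Y,\mathbf 1)$ is a compact $\mathfrak{so}(d+1,1)$-module $H$, maps $\mathbb Y:\mathrm{Conf}_n(\mathbb R^d)\to\mathrm{Hom}_{\mathbb C}(H^{\otimes n},\overline H)$, $x_{[n]}\mapsto\mathbb Y_{x_{[n]}}$ ($n\ge1$), and $\mathbf 1\in H_0$ such that: (unit) $\mathbb Y_{(0)}(a)=a$; (analyticity) $x_{[n]}\mapsto\langle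 u,\mathbb Y_{x_{[n]}}(a_1,\dots,a_n)\rangle$ is real analytic on $\mathrm{Conf}_n(\mathbb R^d)$ for all $u\in H^\vee$, $a_i\in H$; (permutation invariance) $\mathbb Y_{(x^{(1)},\dots,x^{(n)})}(a_1,\dots,a_n)=\mathbb Y_{(x^{(\sigma1)},\dots,x^{(\sigma n)})}(a_{\sigma1},\dots,a_{\sigma n})$ for $\sigma\in S_n$; (vacuum) $\mathbb Y_{(x^{(1)},\dots,x^{(n+1)})}(a_1,\dots,a_n,\mathbf 1)=\mathbb Y_{(x^{(1)},\dots,x^{(n)})}(a_1,\dots,a_n)$ for $n\ge1$; (invariance of vacuum) $X\mathbf 1=0$ for all $X\in\mathfrak{so}(d+1,1)$; (translation invariance) $\mathbb Y_{x_{[n]}}(a_1,\dots,P_\mu a_p,\dots,a_n)=\frac{d}{dx^{(p)}_\mu}\mathbb Y_{x_{[n]}}(a_1,\dots,a_n)$ for all $p,\mu$; (conformal covariance) $X\,\mathbb Y_{x_{[n]}}(a_1,\dots,a_n)=\sum_{q=1}^n\mathbb Y_{x_{[n]}}(a_1,\dots,\tau_{x^{(q)}}(X)a_q,\dots,a_n)$ for all $X\in\mathfrak{so}(d+1,1)$; (strong cluster decomposition) for $n\ge0,m\ge1$, $a_i\in H$, $u\in H^\vee$, the series $\sum_{\Delta}\langle u,\mathbb Y_{(x^{(1)},\dots,x^{(n)},w)}(a_1,\dots,a_n,\mathrm{pr}_\Delta\mathbb Y_{(y^{(1)},\dots,y^{(m)})}(a_{n+1},\dots,a_{n+m}))\rangle$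 converges absolutely on $U_{n,m}$, and its partial sums over $\Delta<M$ converge as $M\to\infty$, uniformly on compact subsets of $U_{n,m}$, to $\langle u,\mathbb Y_{(x^{(1)},\dots,x^{(n)},w+y^{(1)},\dots,w+y^{(m)})}(a_1,\dots,a_{n+m})\rangle$. **Spherical Laurent series.** $\mathbb R[x_1,\dots,x_d,|x|^{\mathbb R}]$ is the quotient of $\mathbb R[x_1,\dots,x_d]\otimes\mathbb R[t^{\mathbb R}]$ (group algebra of $(\mathbb R,+)$) by $x_1^2+\dots+x_d^2-t^2$, with $t=|x|$, graded by $\deg x_\mu=1$, $\deg|x|^r=r$. $H[x_1,\dots,x_d,|x|^{\mathbb R}]_\lambda=H\otimes\mathbb R[x_1,\dots,x_d,|x|^{\mathbb R}]_\lambda$, and $H((x_1,\dots,x_d,|x|^{\mathbb R}))\subset\prod_\lambda H[x_1,\dots,x_d,|x|^{\mathbb R}]_\lambda$ consists of those $(f_\lambda)$ with $\{\lambda<M:f_\lambda\ne0\}$ finite for all $M\in\mathbb R$. Elements $P(x)|x|^r$ are also regarded as real analytic functions on $\mathbb R^d\setminus\{0\}$. **Associated vertex operator.** It is the unique linear map $Y(-,x):H\otimes H\to H((x_1,\dots,x_d,|x|^{\mathbb R}))$, $a\otimes b\mapsto Y(a,x)b$, such that for $u\in H_{\Delta_0}^*$, $a\in H_{\Delta_1}$, $b\in H_{\Delta_2}$ one has $\langle u,Y(a,x)b\rangle\in|x|^{\Delta_0-\Delta_1-\Delta_2}\mathbb C[\frac{x_1}{|x|},\dots,\frac{x_d}{|x|}]$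 and $\langle u,Y(a,x)b\rangle=\langle u,\mathbb Y_{(x,0)}(a,b)\rangle$ as real analytic functions on $\mathbb R^d\setminus\{0\}$ (such a map exists). Each term of the sums above is regarded as a real analytic function in this way. *)

(* Defs.v *)
From HB Require Import structures.
From mathcomp Require Import all_boot all_order all_algebra.
From mathcomp Require Import perm complex.
From mathcomp Require Import all_classical all_reals all_analysis.

Set Implicit Arguments.
Unset Strict Implicit.
Unset Printing Implicit Defensive.

Import Order.TTheory GRing.Theory Num.Theory.
Import numFieldNormedType.Exports.

Local Open Scope classical_set_scope.
Local Open Scope complex_scope.
Local Open Scope ring_scope.

(* [R[i]] carries its topology and its norm through the alias [R[i]^o]. *)

Section Summation.
Variable R : realType.

Definition abs_summable (T : choiceType) (f : T -> R[i]) : Prop :=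
  summable [set: T] (fun t => (ComplexField.Normc.normc (f t))%:E).

Definition has_sum (T : choiceType) (f : T -> R[i]) (s : R[i]) : Prop :=
  abs_summable f /\
  forall e : R, 0 < e -> exists2 A0 : set T, finite_set A0 &
    forall A, finite_set A -> A0 `<=` A ->
      ComplexField.Normc.normc (\sum_(t \in A) f t - s) < e.

End Summation.

Section Analysis.
Variables (R : realType) (d : nat).

Definition enorm (x : 'rV[R]_d) : R := Num.sqrt (\sum_i x 0 i ^+ 2).

(* A point of (R^d)^n is a matrix whose rows are x^(1), ..., x^(n). *)
Definition conf (n : nat) : set 'M[R]_(n, d) :=
  [set x | injective (fun i => row i x)].

Definition analytic_at (n : nat) (f : 'M[R]_(n, d) -> R[i])
    (x : 'M[R]_(n, d)) : Prop :=
  exists (c : {ffun 'I_n * 'I_d -> nat} -> R[i]) (r : R), 0 < r /\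
    forall y, `|y - x| < r ->
      has_sum (fun alpha => c alpha *
        (\prod_p (y p.1 p.2 - x p.1 p.2) ^+ alpha p)%:C) (f y).

Definition analytic_on (n : nat) (U : set 'M[R]_(n, d))
    (f : 'M[R]_(n, d) -> R[i]) : Prop :=
  forall x, U x -> analytic_at f x.

Definition is_cderive (n : nat) (f : 'M[R]_(n, d) -> R[i])
    (x v : 'M[R]_(n, d)) (l : R[i]) : Prop :=
  is_derive x v (fun y => complex.Re (f y)) (complex.Re l) /\
  is_derive x v (fun y => complex.Im (f y)) (complex.Im l).

(* The partial sum over Delta < M of a family in which only finitely many
   indices below M contribute. *)
Definition psum (T : Type) (f : R -> T -> R[i]^o) (M : R) (z : T) : R[i]^o :=
  \sum_(D \in [set D | D < M]) f D z.

Definition cvg_compactly (T : topologicalType) (U : set T)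
    (f : R -> T -> R[i]^o) (g : T -> R[i]^o) : Prop :=
  forall K, compact K -> K `<=` U -> {uniform K, psum f @ +oo --> g}.

Definition cvg_loc_unif (T : topologicalType) (U : set T)
    (f : R -> T -> R[i]^o) (g : T -> R[i]^o) : Prop :=
  forall z, U z -> exists2 V, nbhs z V &
    {uniform V `&` U, psum f @ +oo --> g}.

End Analysis.

Section LieAlgebra.
Variables (R : realType) (d : nat).

Inductive confgen : Type :=
  | GenD
  | GenP of 'I_d
  | GenK of 'I_d
  | GenJ of {p : 'I_d * 'I_d | (p.1 < p.2)%N}.

Definition confgen_code (g : confgen) :
    unit + ('I_d + ('I_d + {p : 'I_d * 'I_d | (p.1 < p.2)%N})) :=
  match g with
  | GenD => inl tt
  | GenP mu => inr (inl mu)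
  | GenK mu => inr (inr (inl mu))
  | GenJ p => inr (inr (inr p))
  end.

Definition confgen_decode
    (s : unit + ('I_d + ('I_d + {p : 'I_d * 'I_d | (p.1 < p.2)%N}))) : confgen :=
  match s with
  | inl _ => GenD
  | inr (inl mu) => GenP mu
  | inr (inr (inl mu)) => GenK mu
  | inr (inr (inr p)) => GenJ p
  end.

Lemma confgen_codeK : cancel confgen_code confgen_decode.
Proof. by case. Qed.

HB.instance Definition _ := Finite.copy confgen (can_type confgen_codeK).

(* so(d+1,1), as the space of coordinate families over the given basis. *)
Definition confalg := {ffun confgen -> R^o}.

Definition gen (g : confgen) : confalg := [ffun h => (h == g)%:R].

Definition eltD : confalg := gen GenD.
Definition eltP (mu : 'I_d) : confalg := gen (GenP mu).
Definition eltK (mu : 'I_d) : confalg := gen (GenK mu).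

(* J_{mu,nu} for all mu, nu, with J_{nu,mu} = - J_{mu,nu}. *)
Definition eltJ (mu nu : 'I_d) : confalg :=
  [ffun h => if h is GenJ p then
     (val p == (mu, nu))%:R - (val p == (nu, mu))%:R else 0].

Definition delta (mu nu : 'I_d) : R := (mu == nu)%:R.

Definition bracketPK (mu nu : 'I_d) : confalg :=
  - 2 *: (delta mu nu *: eltD + eltJ mu nu).

Definition bracketJP (mu nu rho : 'I_d) : confalg :=
  - (delta mu rho *: eltP nu) + delta nu rho *: eltP mu.

Definition bracketJK (mu nu rho : 'I_d) : confalg :=
  - (delta mu rho *: eltK nu) + delta nu rho *: eltK mu.

Definition bracketJJ (mu nu rho sigma : 'I_d) : confalg :=
  delta nu rho *: eltJ mu sigma - delta mu rho *: eltJ nu sigma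
  - delta nu sigma *: eltJ mu rho + delta mu sigma *: eltJ nu rho.

Definition bracket_gen (g h : confgen) : confalg :=
  match g, h with
  | GenD, GenD | GenD, GenJ _ | GenJ _, GenD => 0
  | GenD, GenP mu => eltP mu
  | GenP mu, GenD => - eltP mu
  | GenD, GenK mu => - eltK mu
  | GenK mu, GenD => eltK mu
  | GenP _, GenP _ | GenK _, GenK _ => 0
  | GenP mu, GenK nu => bracketPK mu nu
  | GenK nu, GenP mu => - bracketPK mu nu
  | GenJ p, GenP rho => bracketJP (val p).1 (val p).2 rho
  | GenP rho, GenJ p => - bracketJP (val p).1 (val p).2 rho
  | GenJ p, GenK rho => bracketJK (val p).1 (val p).2 rho
  | GenK rho, GenJ p => - bracketJK (val p).1 (val p).2 rho
  | GenJ p, GenJ q => bracketJJ (val p).1 (val p).2 (val q).1 (val q).2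
  end.

Definition bracket (X Y : confalg) : confalg :=
  \sum_g \sum_h (X g * Y h) *: bracket_gen g h.

Lemma bracketE g h : bracket (gen g) (gen h) = bracket_gen g h.
Proof.
rewrite /bracket (bigD1 g) //= [X in _ + X]big1 => [|g' ng]; last first.
  by apply: big1 => h' _; rewrite ffunE (negbTE ng) mul0r scale0r.
rewrite addr0 (bigD1 h) //= big1 => [|h' nh].
  by rewrite !ffunE !eqxx mulr1 scale1r addr0.
by rewrite [X in _ * X]ffunE (negbTE nh) mulr0 scale0r.
Qed.

Definition adP (x : 'rV[R]_d) (X : confalg) : confalg :=
  \sum_rho x 0 rho *: bracket (eltP rho) X.

(* ad P raises the D-weight, which lies in {-1, 0, 1}, by one. *)
Let weight (g : confgen) : nat :=
  match g with GenK _ => 0 | GenD | GenJ _ => 1 | GenP _ => 2 end.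

Let bracketP_weight mu h g :
  weight g != (weight h).+1 -> bracket_gen (GenP mu) h g = 0.
Proof.
case: h => [|nu|nu|p] /=; case: g => [|ka|ka|q] //= _;
  rewrite /bracketPK /bracketJP /eltP /eltD /gen !ffunE //= ?subr0 ?addr0;
  by rewrite ?(oppr0, scaler0, addr0, subr0, mulr0n, mulr0).
Qed.

Let adP_weight (k : nat) x (X : confalg) :
  (forall g, (weight g < k)%N -> X g = 0) ->
  forall g, (weight g < k.+1)%N -> adP x X g = 0.
Proof.
move=> X0 g gk; rewrite /adP sum_ffunE big1 // => rho _; rewrite ffunE.
rewrite /bracket sum_ffunE big1 ?scaler0 // => g' _; rewrite sum_ffunE big1 //.
move=> h _; rewrite ffunE /eltP ffunE.
have [->|_] := eqVneq g' (GenP rho); last by rewrite mul0r scale0r.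
have [hk|kh] := ltnP (weight h) k; first by rewrite X0 // mulr0 scale0r.
by rewrite bracketP_weight ?scaler0 // neq_ltn (leq_trans gk).
Qed.

Lemma adP_nilpotent x X : iter 3 (adP x) X = 0.
Proof.
apply/ffunP => g; rewrite [RHS]ffunE /=.
apply: (@adP_weight 2); first apply: (@adP_weight 1); first exact: adP_weight.
by case: g.
Qed.

(* exp (- sum_rho x_rho ad P_rho) X; the higher terms vanish by
   [adP_nilpotent]. *)
Definition tau (x : 'rV[R]_d) (X : confalg) : confalg :=
  \sum_(k < 3) (k`!%:R^-1 : R) *: iter k (fun Z => - adP x Z) X.

(* The antisymmetric matrix E_{mu,nu} - E_{nu,mu} corresponds to J_{mu,nu}:
   this is how J_{mu,nu} acts on the span of P_1, ..., P_d. *)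
Definition so_elt (A : 'M[R]_d) : confalg :=
  \sum_(mu < d) \sum_(nu < d | (mu < nu)%N) A mu nu *: eltJ mu nu.

Definition SO : set 'M[R]_d := [set g | g *m g^T = 1%:M /\ \det g = 1].

End LieAlgebra.

Section Linear.
Variables (R : realType) (V : lmodType R[i]).

Definition lin_on (W : lmodType R[i]) (A : set V) (f : V -> W) : Prop :=
  forall (k : R[i]) a b, A a -> A b -> f (k *: a + b) = k *: f a + f b.

Definition lin_indep (n : nat) (v : 'I_n -> V) : Prop :=
  forall k : 'I_n -> R[i], \sum_i k i *: v i = 0 -> forall i, k i = 0.

Definition edim (A : set V) : \bar R :=
  ereal_sup [set n%:R%:E | n in
    [set n | exists v : 'I_n -> V, (forall i, A (v i)) /\ lin_indep v]].

End Linear.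

Section Modules.
Variables (R : realType) (d : nat) (H : lmodType R[i]).

Record conf_module : Type := ConfModule {
  act : confalg R d -> H -> H;
  act_linear_l : forall (k : R) X X' a,
    act (k *: X + X') a = k%:C *: act X a + act X' a;
  act_linear_r : forall X (k : R[i]) a b,
    act X (k *: a + b) = k *: act X a + act X b;
  act_bracket : forall X X' a,
    act (bracket X X') a = act X (act X' a) - act X' (act X a) }.

Variable M : conf_module.

Definition weight_space (D : R) : set H :=
  [set a | act M (eltD R d) a = D%:C *: a].

Definition is_decomp (a : H) (f : R -> H) : Prop :=
  [/\ forall D, weight_space D (f D),
      finite_set [set D | f D != 0] &
      a = \sum_(D \in [set: R]) f D].

(* The representation of so(d) on the D-weight space integrates to a
   representation pi of SO(d): pi (exp A) = exp (so_elt A), where the second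
   exponential series is tested against the linear functionals of the
   (finite-dimensional) weight space. *)
Definition exponentiates (D : R) : Prop :=
  exists pi : 'M[R]_d -> H -> H,
  [/\ forall g, SO g -> lin_on (weight_space D) (pi g),
      forall g a, SO g -> weight_space D a -> weight_space D (pi g a),
      forall a, weight_space D a -> pi 1%:M a = a,
      forall g h a, SO g -> SO h -> weight_space D a ->
        pi (g *m h) a = pi g (pi h a) &
      forall A g : 'M[R]_d, A^T = - A ->
        series (fun k => k`!%:R^-1 *: A ^+ k) @ \oo --> g ->
        forall (l : H -> R[i]^o) a, lin_on (weight_space D) l ->
          weight_space D a ->
          series (fun k => k`!%:R^-1 *: l (iter k (act M (so_elt A)) a)) @ \oo
            --> l (pi g a)].

Definition compact_module : Prop :=
  [/\ forall a, exists! f, is_decomp a f,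
      forall N : R,
        (\esum_(D in [set D : R | (D <= N)%R]) edim (weight_space D) < +oo)%E &
      forall D, exponentiates D].

(* The family of components of a : H; this is also the embedding of H in
   Hbar. *)
Definition comp (a : H) : R -> H := xget (fun=> 0) [set f | is_decomp a f].

Definition Hbar : set (R -> H) := [set f | forall D, weight_space D (f D)].

(* The generators change the weight by -1, 0 or 1, so that the sum
   below is finite for f in Hbar. *)
Definition act_bar (X : confalg R d) (f : R -> H) : R -> H :=
  fun D => \sum_(D' \in [set: R]) comp (act M X (f D')) D.

(* H^vee, the direct sum of the duals of the weight spaces. The values of
   [dual_fun D] outside of the D-weight space play no role. *)
Record Hdual : Type := HDual {
  dual_fun : R -> H -> R[i]^o;
  dual_linear : forall D, lin_on (weight_space D) (dual_fun D);
  dual_finite :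
    finite_set [set D | exists2 a, weight_space D a & dual_fun D a != 0] }.

Definition pairing (u : Hdual) (f : R -> H) : R[i]^o :=
  \sum_(D \in [set: R]) dual_fun u D (f D).

End Modules.

Section CCSystem.
Variables (R : realType) (d : nat) (H : lmodType R[i]).

Definition update (n : nat) (a : 'I_n -> H) (p : 'I_n) (b : H) : 'I_n -> H :=
  fun q => if q == p then b else a q.

Definition fcat (n m : nat) (a : 'I_n -> H) (b : 'I_m -> H) : 'I_(n + m) -> H :=
  fun i => match fintype.split i with inl j => a j | inr j => b j end.

(* For n = 0 the inequalities are void, so that this is
   Conf_1 x Conf_m. *)
Definition cluster_dom (n m : nat) : set ('M[R]_(n + 1, d) * 'M[R]_(m, d)) :=
  [set z | [/\ conf z.1, conf z.2 &
    forall k l, enorm (row l z.2) < enorm (row k (usubmx z.1) - dsubmx z.1)]].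

Definition cluster_conf (n m : nat)
    (z : 'M[R]_(n + 1, d) * 'M[R]_(m, d)) : 'M[R]_(n + m, d) :=
  col_mx (usubmx z.1) (\matrix_l (dsubmx z.1 + row l z.2)).

(* [corr x a] is Y_x(a_1, ..., a_n); its values for n = 0 or for x outside of
   [conf n] play no role. *)
Record cc_system : Type := CCSystem {
  cc_module :> conf_module d H;
  cc_compact : compact_module cc_module;
  corr : forall n, 'M[R]_(n, d) -> ('I_n -> H) -> R -> H;
  vac : H;
  corr_Hbar : forall n (x : 'M[R]_(n, d)) a, (0 < n)%N -> conf x ->
    Hbar cc_module (corr x a);
  corr_multilinear : forall n (x : 'M[R]_(n, d)) a p (k : R[i]) b c D,
    (0 < n)%N -> conf x ->
    corr x (update a p (k *: b + c)) D =
      k *: corr x (update a p b) D + corr x (update a p c) D;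
  vac_weight : weight_space cc_module 0 vac;
  corr_unit : forall a, corr (0 : 'M[R]_(1, d)) (fun=> a) = comp cc_module a;
  corr_analytic : forall n (u : Hdual cc_module) (a : 'I_n -> H), (0 < n)%N ->
    analytic_on (@conf R d n) (fun x => pairing u (corr x a));
  corr_perm : forall n (x : 'M[R]_(n, d)) a (s : 'S_n), (0 < n)%N -> conf x ->
    corr x a = corr (row_perm s x) (fun i => a (s i));
  corr_vac : forall n (x : 'M[R]_(n + 1, d)) (a : 'I_n -> H), (0 < n)%N ->
    conf x -> corr x (fcat a (fun=> vac)) = corr (usubmx x) a;
  vac_invariant : forall X, act cc_module X vac = 0;
  corr_translation : forall n (x : 'M[R]_(n, d)) a p mu (u : Hdual cc_module),
    (0 < n)%N -> conf x ->
    is_cderive (fun y => pairing u (corr y a)) x (delta_mx p mu)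
      (pairing u (corr x (update a p (act cc_module (eltP R mu) (a p)))));
  corr_covariant : forall n (x : 'M[R]_(n, d)) a X D, (0 < n)%N -> conf x ->
    act_bar cc_module X (corr x a) D =
      \sum_q corr x (update a q (act cc_module (tau (row q x) X) (a q))) D;
  corr_cluster : forall n m (a : 'I_n -> H) (b : 'I_m -> H)
      (u : Hdual cc_module), (0 < m)%N ->
    let term (D : R) (z : 'M[R]_(n + 1, d) * 'M[R]_(m, d)) :=
      pairing u (corr z.1 (fcat a (fun=> corr z.2 b D))) in
    (forall z, cluster_dom z -> abs_summable (term^~ z)) /\
    cvg_compactly (@cluster_dom n m) term
      (fun z => pairing u (corr (cluster_conf z) (fcat a b))) }.

End CCSystem.

(* V[x_1, ..., x_d, |x|^R] and V((x_1, ..., x_d, |x|^R)). A family of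
   coefficients c : sph_mon -> V stands for the sum of the
   c (alpha, r) x^alpha t^r with t = |x|; it represents an element of a quotient
   by the multiples of x_1^2 + ... + x_d^2 - t^2. *)
Section SphericalSeries.
Variables (R : realType) (d : nat) (V : lmodType R[i]).

Definition sph_mon := ({ffun 'I_d -> nat} * R)%type.

Definition sph_deg (m : sph_mon) : R := (\sum_i m.1 i)%:R + m.2.

Definition finite_coeffs (c : sph_mon -> V) : Prop :=
  finite_set [set m | c m != 0].

(* The product of x_1^2 + ... + x_d^2 - t^2 with q. *)
Definition mul_sph_rel (q : sph_mon -> V) : sph_mon -> V := fun m =>
  \sum_(i | (1 < m.1 i)%N)
     q ([ffun j => if j == i then (m.1 j - 2)%N else m.1 j], m.2)
  - q (m.1, m.2 - 2).

Definition sph_null (c : sph_mon -> V) : Prop :=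
  exists2 q, finite_coeffs q & c = mul_sph_rel q.

Definition sph_part (c : sph_mon -> V) (lambda : R) : sph_mon -> V :=
  fun m => if sph_deg m == lambda then c m else 0.

Definition sph_series : set (sph_mon -> V) :=
  [set c | (forall lambda, finite_coeffs (sph_part c lambda)) /\
    forall N : R, finite_set
      [set lambda | lambda < N /\ ~ sph_null (sph_part c lambda)]].

Definition sph_eq (c c' : sph_mon -> V) : Prop :=
  forall lambda, sph_null (sph_part (fun m => c m - c' m) lambda).

Definition sph_mon_eval (m : sph_mon) (x : 'rV[R]_d) : R :=
  (\prod_i x 0 i ^+ m.1 i) * enorm x `^ m.2.

(* The value at x != 0 of a series with finitely many nonzero homogeneous
   components; a null component contributes 0. *)
Definition sph_eval (c : sph_mon -> V) (x : 'rV[R]_d) : V :=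
  \sum_(lambda \in [set: R]) \sum_(m \in [set: sph_mon])
    (sph_mon_eval m x)%:C *: sph_part c lambda m.

(* |x|^lambda p(x_1 / |x|, ..., x_d / |x|), for p with coefficients c. *)
Definition sph_homog (c : {ffun 'I_d -> nat} -> V) (lambda : R) :
    sph_mon -> V :=
  fun m => if sph_deg m == lambda then c m.1 else 0.

End SphericalSeries.

Section VertexOperator.
Variables (R : realType) (d : nat) (H : lmodType R[i]) (S : cc_system d H).

Definition sph_bilinear (Y : H -> H -> sph_mon R d -> H) : Prop :=
  (forall (k : R[i]) a a' b, sph_eq (Y (k *: a + a') b)
     (fun m => k *: Y a b m + Y a' b m)) /\
  (forall (k : R[i]) a b b', sph_eq (Y a (k *: b + b'))
     (fun m => k *: Y a b m + Y a b' m)).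

Definition pair_conf (x y : 'rV[R]_d) : 'M[R]_(1 + 1, d) := col_mx x y.

Definition is_vertex_operator (Y : H -> H -> sph_mon R d -> H) : Prop :=
  [/\ forall a b, sph_series (Y a b),
      sph_bilinear Y &
      forall (D0 D1 D2 : R) (l : H -> R[i]^o) (a b : H),
        lin_on (weight_space S D0) l ->
        weight_space S D1 a -> weight_space S D2 b ->
        let f : sph_mon R d -> R[i]^o := fun m => l (comp S (Y a b m) D0) in
        (exists2 c : {ffun 'I_d -> nat} -> R[i]^o,
           finite_set [set alpha | c alpha != 0] &
           sph_eq f (sph_homog c (D0 - D1 - D2))) /\
        (forall x, x != 0 ->
           sph_eval f x =
             l (corr S (pair_conf x 0) (fcat (fun=> a) (fun=> b)) D0))].

Variable Y : H -> H -> sph_mon R d -> H.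

(* pr_D Y(a,x)b, a polynomial in x_1, ..., x_d and powers of |x| with
   coefficients in the D-weight space, at a point x != 0. *)
Definition pr_vertex (D : R) (a : H) (x : 'rV[R]_d) (b : H) : H :=
  sph_eval (fun m => comp S (Y a b m) D) x.

Definition pairing_vertex (u : Hdual S) (a : H) (x : 'rV[R]_d) (b : H) :
    R[i]^o :=
  sph_eval (fun m => pairing u (comp S (Y a b m))) x.

(* <u, Y(a1,x1) pr_D Y(a2,x2) a3> *)
Definition product_term (u : Hdual S) (a1 a2 a3 : H) (D : R)
    (x1 x2 : 'rV[R]_d) : R[i]^o :=
  pairing_vertex u a1 x1 (pr_vertex D a2 x2 a3).

(* <u, Y(pr_D Y(a1,x0) a2, x2) a3> *)
Definition iterate_term (u : Hdual S) (a1 a2 a3 : H) (D : R)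
    (x0 x2 : 'rV[R]_d) : R[i]^o :=
  pairing_vertex u (pr_vertex D a1 x0 a2) x2 a3.

End VertexOperator.

(* Y_2(R^d); the rows of z are x^(1) and x^(2). *)
Definition Y2 (R : realType) (d : nat) : set 'M[R]_(1 + 1, d) :=
  [set z | [/\ usubmx z != 0, dsubmx z != 0 & usubmx z != dsubmx z]].

(* Main.v *)
Require Import Defs.
From HB Require Import structures.
From mathcomp Require Import all_boot all_order all_algebra.
From mathcomp Require Import perm complex finmap.
From mathcomp Require Import all_classical all_reals all_analysis.
Import Order.TTheory GRing.Theory Num.Theory.
Import numFieldNormedType.Exports.

Local Open Scope classical_set_scope.
Local Open Scope complex_scope.
Local Open Scope ring_scope.

Set Implicit Arguments.
Unset Strict Implicit.
Unset Printing Implicit Defensive.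

(** Why the statement holds.  On the locus x <> 0 the projection pr_D Y(a,x)b is
    nothing but the D-component of the two-point map at (x, 0), for arbitrary
    a and b ([pr_vertexE], [pairing_vertexE]).  Hence a term of either series
    is a term of a cluster expansion with one outer point, a cluster centre and
    a cluster made of two points, the second one at the origin of the cluster:

    - <u, Y(a1,x1) pr_D Y(a2,x2) a3> has outer point x1, centre 0 and cluster
      (x2, 0), so that the cluster axiom resums it to the three-point function
      at (x1, x2, 0), in the domain |x1| > |x2| > 0;
    - <u, Y(pr_D Y(a1,x0) a2, x2) a3>, after exchanging its two outermost
      arguments by permutation invariance, has outer point 0, centre x2 and
      cluster (x0, 0), and resums to the three-point function at
      (0, x2 + x0, x2), in the domain |x2| > |x0| > 0.

    Permutation invariance identifies all these limits with
    phi(x1, x2) = <u, Y_(x1,x2,0)(a1, a2, a3)> ([three_point]), which is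
    analytic on Y_2 because (x1, x2, 0) is then a configuration.

    The substance of the proof is the first claim.  The vertex operator is
    known only through functionals on weight spaces applied to homogeneous
    arguments, only modulo the relation |x|^2 = x_1^2 + ... + x_d^2, and its
    value is a sum over degrees that is meaningful only if finitely many degrees
    contribute.  So one shows that evaluation in a fixed degree kills that
    relation ([mul_sph_rel_eval]), that functionals separate the vectors of a
    weight space, which has finite dimension ([weight_separation]), that for
    homogeneous a and b a single degree contributes ([vertex_part_homog]), and
    extends to all a and b by bilinearity ([vertex_part_sum]).

    On the analytic side, uniform convergence on compact sets becomes local
    uniform convergence because spaces of real matrices are locally compact
    ([locally_compact_mx], [cvg_loc_unif_pullback]), and analyticity of phi
    comes from restricting a power series to the affine subspace of the triples
    that end with 0 ([analytic_at_restriction]). *)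

(** * Finite sums and linear maps on subspaces *)

Section FiniteSums.
Variable (T : choiceType).

Lemma finite_set_fset (A : set T) :
  finite_set A -> exists s : {fset T}, forall t, A t -> t \in s.
Proof.
by move=> fA; exists (fset_set A) => t At; rewrite in_fset_set // inE.
Qed.

Lemma fsum_fset (V : nmodType) (s : {fset T}) (f : T -> V) :
  (forall t, f t != 0 -> t \in s) ->
  \sum_(t \in [set: T]) f t = \sum_(t <- s) f t.
Proof.
move=> fs; apply: fsbigTE => t ts; apply/eqP; apply: contraNT ts; exact: fs.
Qed.

Lemma finite_set_comb (K : pzRingType) (V : lmodType K) (k : K) (f g : T -> V) :
  finite_set [set t | f t != 0] -> finite_set [set t | g t != 0] ->
  finite_set [set t | k *: f t + g t != 0].
Proof.
move=> ff fg; apply: sub_finite_set (_ : finite_set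
  ([set t | f t != 0] `|` [set t | g t != 0])); last by rewrite finite_setU.
move=> t /=; have [->|] := eqVneq (f t) 0; last by left.
by rewrite scaler0 add0r; right.
Qed.

Lemma fsum_linear (K : pzRingType) (V : lmodType K) (k : K) (f g : T -> V) :
  finite_set [set t | f t != 0] -> finite_set [set t | g t != 0] ->
  \sum_(t \in [set: T]) (k *: f t + g t) =
    k *: (\sum_(t \in [set: T]) f t) + \sum_(t \in [set: T]) g t.
Proof.
move=> /finite_set_fset[s fs] /finite_set_fset[s' gs].
rewrite !(@fsum_fset _ (s `|` s')%fset) ?scaler_sumr ?big_split // => t h;
  rewrite inE.
- by rewrite gs ?orbT.
- by rewrite fs.
have [f0|/fs -> //] := eqVneq (f t) 0.
by move: h; rewrite f0 scaler0 add0r => /gs ->; rewrite orbT.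
Qed.

(** A sum over an infinite support is 0 by convention, so that finiteness of the
    supports cannot be dropped. *)
Lemma fsum_exchange (K : pzRingType) (V : lmodType K) (I : Type) (s : seq I)
    (F : I -> T -> V) : (forall i, finite_set [set t | F i t != 0]) ->
  \sum_(t \in [set: T]) \sum_(i <- s) F i t =
    \sum_(i <- s) \sum_(t \in [set: T]) F i t.
Proof.
move=> fF; suff [] : finite_set [set t | \sum_(i <- s) F i t != 0] /\
  \sum_(t \in [set: T]) \sum_(i <- s) F i t =
    \sum_(i <- s) \sum_(t \in [set: T]) F i t by [].
elim: s => [|i s [fs IH]].
  rewrite big_nil; under eq_fsbigr do rewrite big_nil.
  rewrite fsbig1 //; split=> //; apply: sub_finite_set (finite_set0 T) => t /=.
  by rewrite big_nil eqxx.
rewrite big_cons -IH; split.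
  apply: sub_finite_set (finite_set_comb 1 (fF i) fs) => t /=.
  by rewrite big_cons scale1r.
rewrite -[X in X + _]scale1r -fsum_linear //.
by apply: eq_fsbigr => t _; rewrite big_cons scale1r.
Qed.

End FiniteSums.

Section LinOn.
Variables (R : realType) (V : lmodType R[i]).

(** Linearity of the functionals of interest is known only on a weight space;
    [submod] is the closure condition that makes [lin_on] usable there. *)
Definition submod (A : set V) : Prop :=
  A 0 /\ forall (k : R[i]) a b, A a -> A b -> A (k *: a + b).

Lemma submodT : submod [set: V]. Proof. by []. Qed.

Variables (W : lmodType R[i]) (A : set V) (l : V -> W).
Hypotheses (subA : submod A) (linl : lin_on A l).

Lemma lin_on0 : l 0 = 0.
Proof.
have := linl (-1) (proj1 subA) (proj1 subA).
by rewrite scaler0 add0r scaleN1r addNr.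
Qed.

Lemma lin_on_sum (T : Type) (s : seq T) (f : T -> V) : (forall t, A (f t)) ->
  A (\sum_(t <- s) f t) /\ l (\sum_(t <- s) f t) = \sum_(t <- s) l (f t).
Proof.
have [A0 Al] := subA.
move=> Af; elim: s => [|t s [IH IHl]]; first by rewrite !big_nil lin_on0.
rewrite !big_cons -[f t]scale1r; split; first exact: Al.
by rewrite linl // IHl !scale1r.
Qed.

Lemma lin_on_fsum (T : choiceType) (f : T -> V) : (forall t, A (f t)) ->
  finite_set [set t | f t != 0] ->
  A (\sum_(t \in [set: T]) f t) /\
  l (\sum_(t \in [set: T]) f t) = \sum_(t \in [set: T]) l (f t).
Proof.
move=> Af /finite_set_fset[s fs].
have [As ls] := lin_on_sum s Af.
rewrite (fsum_fset (s := s)) // [X in _ /\ _ = X](fsum_fset (s := s)) // => t.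
apply: contraNT => /(contraNN (@fs t)); rewrite negbK => /eqP ->.
by rewrite lin_on0.
Qed.

End LinOn.

(** * Functionals separate the vectors of a finite-dimensional subspace *)

Section Separation.
Variables (R : realType) (V : lmodType R[i]).

Lemma edim_fin_bound (A : set V) : (edim A < +oo)%E ->
  exists N : nat, forall n (v : 'I_n -> V),
    (forall i, A (v i)) -> lin_indep v -> (n <= N)%N.
Proof.
move=> Afin.
have ge n (v : 'I_n -> V) : (forall i, A (v i)) -> lin_indep v ->
    (n%:R%:E <= edim A)%E.
  by move=> Av iv; apply: ereal_sup_ubound; exists n => //; exists v.
have [r er] : exists r : R, (edim A <= r%:E)%E.
  case: (edim A) Afin => [r _||] //; first by exists r.
  by exists 0; rewrite leNye.
exists (Num.truncn r) => n v Av iv.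
have := le_trans (ge n v Av iv) er; rewrite lee_fin => nr.
by rewrite Num.Theory.truncn_ge_nat // (le_trans _ nr).
Qed.

(** Among the linearly independent families in A that start with a nonzero
    vector a, take a longest one: it spans A, and the coordinate along a is a
    functional that is 1 at a. *)
Lemma lin_on_separates (A : set V) (a : V) : submod A -> (edim A < +oo)%E ->
  A a -> (forall l : V -> R[i]^o, lin_on A l -> l a = 0) -> a = 0.
Proof.
move=> [A0 Al] /edim_fin_bound[N Nub] Aa la; apply: contrapT => /eqP a0.
pose Q n := `[< exists v : 'I_n.+1 -> V,
  [/\ forall i, A (v i), lin_indep v & v ord0 = a] >].
have exQ : exists n, Q n.
  exists 0%N; apply/asboolP; exists (fun=> a); split => // k.
  rewrite big_ord1 => /eqP; rewrite scaler_eq0 (negbTE a0) orbF => /eqP k0 i.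
  by rewrite ord1.
have ubQ n : Q n -> (n <= N)%N.
  by move=> /asboolP[v [Av iv _]]; apply/ltnW/(Nub _ v).
case: (ex_maxnP exQ ubQ) => n /asboolP[v [Av iv va]] maxn.
have spans w : A w -> exists k : 'I_n.+1 -> R[i], w = \sum_i k i *: v i.
  move=> Aw; apply: contrapT => nk.
  (* otherwise v could be prolonged by w, against its maximality *)
  suff /maxn : Q n.+1 by rewrite ltnn.
  pose v' (i : 'I_n.+2) := if unlift ord_max i is Some j then v j else w.
  have v'm : v' ord_max = w by rewrite /v' unlift_none.
  have v'l j : v' (lift ord_max j) = v j by rewrite /v' liftK.
  have wid (j : 'I_n.+1) : widen_ord (leqnSn n.+1) j = lift ord_max j.
    by apply/val_inj; rewrite /= /bump leqNgt ltn_ord add0n.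
  apply/asboolP; exists v'; split.
  - by move=> i; rewrite /v'; case: unliftP.
  - move=> k; rewrite big_ord_recr /= v'm.
    under eq_bigr do rewrite wid v'l.
    have [km|km] := eqVneq (k ord_max) 0.
      rewrite km scale0r addr0 => /(iv (fun j => k (lift ord_max j))) kl i.
      by case: (unliftP ord_max i) => [j ->|->].
    move=> /eqP; rewrite addrC addr_eq0 => /eqP kw; exfalso; apply: nk.
    exists (fun i => - (k ord_max)^-1 * k (lift ord_max i)).
    rewrite -[w](scalerK km) kw scalerN -scaleNr scaler_sumr.
    by apply: eq_bigr => i _; rewrite scalerA.
  - by rewrite -[RHS]va -v'l; congr v'; apply/val_inj.
have uniq_coord (k k' : 'I_n.+1 -> R[i]) :
    \sum_i k i *: v i = \sum_i k' i *: v i -> k =1 k'.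
  move=> /eqP; rewrite -subr_eq0 -sumrB => /eqP kk i; apply/eqP.
  rewrite -subr_eq0; apply/eqP/(iv (fun i => k i - k' i)).
  by rewrite -[RHS]kk; apply: eq_bigr => j _; rewrite scalerBl.
pose coord_of w := [set k : 'I_n.+1 -> R[i] | w = \sum_i k i *: v i].
pose coords w := xget (fun=> 0) (coord_of w).
have coordsP w : A w -> w = \sum_i coords w i *: v i.
  by move=> /spans exk; exact: (@xgetPex _ (fun=> 0) (coord_of w)).
have lin0 : lin_on A (fun w => coords w ord0 : R[i]^o).
  move=> k w w' Aw Aw'.
  apply: (uniq_coord _ (fun i => k * coords w i + coords w' i) _ ord0).
  rewrite -coordsP; last exact: Al.
  under [RHS]eq_bigr do rewrite scalerDl -scalerA.
  by rewrite big_split -scaler_sumr /= -!coordsP.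
have /eqP := la _ lin0; apply/negP.
have -> : coords a ord0 = (ord0 == ord0 :> 'I_n.+1)%:R.
  apply: (uniq_coord _ (fun i => (i == ord0)%:R) _ ord0); rewrite -coordsP //.
  rewrite (bigD1 ord0) //= scale1r big1 ?addr0 ?va // => i /negbTE ->.
  by rewrite scale0r.
by rewrite eqxx oner_eq0.
Qed.

End Separation.

(** * Evaluation of spherical series *)

Section SphericalEvaluation.
Variables (R : realType) (d : nat).
Implicit Types x : 'rV[R]_d.

Lemma enorm_ge0 x : 0 <= enorm x. Proof. exact: sqrtr_ge0. Qed.

Lemma enorm_sqr x : enorm x ^+ 2 = \sum_i x 0 i ^+ 2.
Proof. by rewrite sqr_sqrtr // sumr_ge0 // => i _; rewrite sqr_ge0. Qed.

Lemma enorm_gt0 x : (0 < enorm x) = (x != 0).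
Proof.
rewrite lt0r enorm_ge0 andbT; apply/idP/idP; apply: contra => /eqP x0.
  by rewrite -[_ == _](expf_eq0 _ 2) enorm_sqr big1 // => i _;
     rewrite x0 mxE expr0n.
apply/eqP/rowP => i; rewrite mxE; apply/eqP.
have /eqP := enorm_sqr x; rewrite x0 expr0n eq_sym psumr_eq0; last first.
  by move=> j _; rewrite sqr_ge0.
by move=> /allP/(_ i); rewrite mem_index_enum sqrf_eq0 => /(_ isT).
Qed.

Lemma enorm0 : enorm (0 : 'rV[R]_d) = 0.
Proof. by rewrite /enorm big1 ?sqrtr0 // => i _; rewrite mxE expr0n. Qed.

Lemma enormN x : enorm (- x) = enorm x.
Proof. by congr Num.sqrt; apply: eq_bigr => i _; rewrite mxE sqrrN. Qed.

Variable V : lmodType R[i].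
Implicit Types c q : sph_mon R d -> V.

(** The inner sum of [sph_eval].  On [sph_series] it is a finite sum, hence
    linear in c; the sum over all degrees need not be. *)
Definition part_eval c (lambda : R) x : V :=
  \sum_(m \in [set: sph_mon R d])
    (sph_mon_eval m x)%:C *: sph_part c lambda m.

Lemma part_eval_finite c lambda x : finite_coeffs (sph_part c lambda) ->
  finite_set [set m | (sph_mon_eval m x)%:C *: sph_part c lambda m != 0].
Proof.
apply: sub_finite_set => m /=; apply: contra_neq => ->; exact: scaler0.
Qed.

Lemma finite_coeffs_comb k c c' lambda :
  finite_coeffs (sph_part c lambda) -> finite_coeffs (sph_part c' lambda) ->
  finite_coeffs (sph_part (fun m => k *: c m + c' m) lambda).
Proof.
move=> fc fc'; apply: sub_finite_set (finite_set_comb k fc fc') => m /=.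
by rewrite /sph_part; case: ifP => // _; rewrite scaler0 addr0.
Qed.

Lemma part_eval_linear k c c' lambda x :
  finite_coeffs (sph_part c lambda) -> finite_coeffs (sph_part c' lambda) ->
  part_eval (fun m => k *: c m + c' m) lambda x =
    k *: part_eval c lambda x + part_eval c' lambda x.
Proof.
move=> fc fc'; rewrite -fsum_linear; [|exact: part_eval_finite..].
apply: eq_fsbigr => m _; rewrite /sph_part; case: ifP => _.
  by rewrite scalerDr !scalerA mulrC.
by rewrite !scaler0 addr0.
Qed.

(** The relation x_1^2 + ... + x_d^2 - t^2 vanishes at t = |x|.  Here x <> 0 is
    needed for |x|^(r + 2) = |x|^r |x|^2.  In the proof, [sh i] multiplies a
    monomial by x_i^2 and [rs] multiplies it by t^2. *)
Lemma mul_sph_rel_eval q x : finite_coeffs q -> x != 0 ->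
  \sum_(m \in [set: sph_mon R d]) (sph_mon_eval m x)%:C *: mul_sph_rel q m = 0.
Proof.
move=> /finite_set_fset[s qs] x0.
pose sh (i : 'I_d) (m : sph_mon R d) : sph_mon R d :=
  ([ffun j => if j == i then (m.1 j + 2)%N else m.1 j], m.2).
pose us (i : 'I_d) (m : sph_mon R d) : sph_mon R d :=
  ([ffun j => if j == i then (m.1 j - 2)%N else m.1 j], m.2).
pose rs (m : sph_mon R d) : sph_mon R d := (m.1, m.2 + 2).
have shK i : cancel (sh i) (us i).
  case=> al r; congr pair; apply/ffunP => j; rewrite !ffunE.
  by case: eqP => // _; rewrite addnK.
have usK i (m : sph_mon R d) : (1 < m.1 i)%N -> sh i (us i m) = m.
  case: m => al r /= ai; congr pair; apply/ffunP => j; rewrite !ffunE.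
  by case: eqP => // ->; rewrite subnK.
have sh_gt i (m : sph_mon R d) : (1 < (sh i m).1 i)%N.
  by rewrite ffunE eqxx addn2.
have rsK : cancel rs (fun m : sph_mon R d => (m.1, m.2 - 2)).
  by case=> al r; rewrite /rs /= addrK.
have rsK' : cancel (fun m : sph_mon R d => (m.1, m.2 - 2)) rs.
  by case=> al r; rewrite /rs /= subrK.
have esh i (m : sph_mon R d) :
    sph_mon_eval (sh i m) x = x 0 i ^+ 2 * sph_mon_eval m x.
  rewrite /sph_mon_eval mulrA; congr (_ * _).
  rewrite [in LHS](bigD1 i) //= [in RHS](bigD1 i) //= ffunE eqxx exprD.
  rewrite [X in X * _ = _]mulrC -[LHS]mulrA; congr (_ * (_ * _)).
  by apply: eq_bigr => j /negbTE ji; rewrite ffunE ji.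
have ers (m : sph_mon R d) :
    sph_mon_eval (rs m) x = enorm x ^+ 2 * sph_mon_eval m x.
  rewrite /sph_mon_eval mulrCA; congr (_ * _).
  rewrite powRD; last first.
    by apply/implyP => _; move: x0; rewrite -enorm_gt0 => /lt0r_neq0.
  by rewrite powR_mulrn ?enorm_ge0 // mulrC.
pose e (m : sph_mon R d) := (sph_mon_eval m x)%:C.
pose g i (m : sph_mon R d) := if (1 < m.1 i)%N then e m *: q (us i m) else 0.
pose h (m : sph_mon R d) := e m *: q (m.1, m.2 - 2).
pose I := \sum_(m \in [set: sph_mon R d]) e m *: q m.
have sumg i : \sum_(m \in [set: sph_mon R d]) g i m = (x 0 i ^+ 2)%:C *: I.
  rewrite (fsum_fset (s := [fset sh i m | m in s]%fset)); last first.
    move=> m; rewrite /g; case: ifP => [mi|]; last by rewrite eqxx.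
    move=> qm; apply/imfsetP; exists (us i m); last by rewrite usK.
    by apply: qs; apply: contra qm => /eqP ->; rewrite scaler0.
  rewrite big_imfset /=; last by move=> m m' _ _ /(can_inj (shK i)).
  rewrite /I (fsum_fset (s := s)); last first.
    by move=> m qm; apply: qs; apply: contra qm => /eqP ->; rewrite scaler0.
  rewrite scaler_sumr; apply: eq_bigr => m _.
  by rewrite /g sh_gt shK /e esh rmorphM scalerA.
have sumh : \sum_(m \in [set: sph_mon R d]) h m = (enorm x ^+ 2)%:C *: I.
  rewrite (reindex_fsbigT rs); last first.
    by exists (fun m : sph_mon R d => (m.1, m.2 - 2)).
  rewrite /I !(fsum_fset (s := s)); first last.
  - move=> m; rewrite /h rsK => qm; apply: qs.
    by apply: contra qm => /eqP ->; rewrite scaler0.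
  - by move=> m qm; apply: qs; apply: contra qm => /eqP ->; rewrite scaler0.
  rewrite scaler_sumr; apply: eq_bigr => m _.
  by rewrite /h rsK /e ers rmorphM scalerA.
(* a finite set of monomials that contains the supports of h and of all g i *)
pose S := (\big[fsetU/fset0]_(i < d) [fset sh i m | m in s] `|`
  [fset rs m | m in s])%fset.
have Sg i m : g i m != 0 -> m \in S.
  rewrite /g; case: ifP => [mi|]; last by rewrite eqxx.
  move=> qm; rewrite inE; apply/orP; left; apply/bigfcupP; exists i => //.
    by rewrite mem_index_enum.
  apply/imfsetP; exists (us i m); last by rewrite usK.
  by apply: qs; apply: contra qm => /eqP ->; rewrite scaler0.
have Sh m : h m != 0 -> m \in S.
  move=> qm; rewrite inE; apply/orP; right; apply/imfsetP.
  exists (m.1, m.2 - 2); last by rewrite rsK'.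
  by apply: qs; apply: contra qm => /eqP; rewrite /h => ->; rewrite scaler0.
transitivity (\sum_(m \in [set: sph_mon R d]) (\sum_i g i m - h m)).
  apply: eq_fsbigr => m _; rewrite /mul_sph_rel scalerBr scaler_sumr.
  by rewrite [in LHS]big_mkcond.
have -> : \sum_(m \in [set: sph_mon R d]) (\sum_i g i m - h m) =
    \sum_(m <- S) (\sum_i g i m - h m).
  apply: fsum_fset => m; apply: contraNT => mS.
  have -> : h m = 0 by apply/eqP; apply: contraNT mS; exact: Sh.
  rewrite subr0; apply/eqP/big1 => i _; apply/eqP.
  by apply: contraNT mS; exact: Sg.
rewrite sumrB exchange_big /= -(fsum_fset Sh) sumh.
under eq_bigr => i _ do rewrite -(fsum_fset (@Sg i)) sumg.
by rewrite -scaler_suml -rmorph_sum /= enorm_sqr subrr.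
Qed.

(** Evaluation in one degree is well defined on the quotient by the relation, as
    the two series need only have finitely many coefficients in that degree. *)
Lemma part_eval_eq c c' lambda x : x != 0 ->
  finite_coeffs (sph_part c lambda) -> finite_coeffs (sph_part c' lambda) ->
  sph_null (sph_part (fun m => c m - c' m) lambda) ->
  part_eval c lambda x = part_eval c' lambda x.
Proof.
move=> x0 fc fc' [q fq eq_cq]; apply/eqP; rewrite -subr_eq0 addrC -scaleN1r.
rewrite -part_eval_linear //; apply/eqP; rewrite -[RHS](mul_sph_rel_eval fq x0).
rewrite -eq_cq; apply: eq_fsbigr => m _; congr (_ *: _); rewrite /sph_part.
by rewrite scaleN1r addrC.
Qed.

Lemma sph_evalE c x :
  sph_eval c x = \sum_(lambda \in [set: R]) part_eval c lambda x.
Proof. by []. Qed.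

Lemma finite_coeffs_homog (c : {ffun 'I_d -> nat} -> V) mu lambda :
  finite_set [set alpha | c alpha != 0] ->
  finite_coeffs (sph_part (sph_homog c mu) lambda).
Proof.
move=> fc.
(* a monomial of the homogeneous series is determined by its polynomial part *)
pose mon (al : {ffun 'I_d -> nat}) : sph_mon R d := (al, mu - (\sum_i al i)%:R).
apply: sub_finite_set (finite_image mon fc).
move=> [al r]; rewrite /= /sph_part /sph_homog.
case: ifP => _; last by rewrite eqxx.
case: ifP => [/eqP deg cal|]; last by rewrite eqxx.
by exists al => //; rewrite /mon -deg /sph_deg /= addrAC subrr add0r.
Qed.

Lemma part_eval_homog (c : {ffun 'I_d -> nat} -> V) mu lambda x :
  lambda != mu -> part_eval (sph_homog c mu) lambda x = 0.
Proof.
move=> lm; apply: fsbig1 => m _; rewrite /sph_part /sph_homog.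
by case: eqP => [->|_]; rewrite ?(negbTE lm) scaler0.
Qed.

End SphericalEvaluation.

Section SphericalMaps.
Variables (R : realType) (d : nat) (V W : lmodType R[i]).
Variables (A : set V) (l : V -> W) (subA : submod A) (linl : lin_on A l).
Variables (c : sph_mon R d -> V) (Ac : forall m, A (c m)).

Lemma sph_part_map lambda :
  sph_part (fun m => l (c m)) lambda = fun m => l (sph_part c lambda m).
Proof.
apply/funext => m; rewrite /sph_part; case: ifP => // _.
by rewrite (lin_on0 subA linl).
Qed.

Lemma finite_coeffs_map lambda : finite_coeffs (sph_part c lambda) ->
  finite_coeffs (sph_part (fun m => l (c m)) lambda).
Proof.
rewrite sph_part_map; apply: sub_finite_set => m /=.
by apply: contra_neq => ->; rewrite (lin_on0 subA linl).
Qed.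

Lemma part_eval_map lambda x : finite_coeffs (sph_part c lambda) ->
  A (part_eval c lambda x) /\
  l (part_eval c lambda x) = part_eval (fun m => l (c m)) lambda x.
Proof.
move=> fc; have [A0 Al] := subA.
have AZ k v : A v -> A (k *: v) by move=> Av; rewrite -[_ *: _]addr0; exact: Al.
have Am m : A ((sph_mon_eval m x)%:C *: sph_part c lambda m).
  by apply: AZ; rewrite /sph_part; case: ifP.
have [Asum ->] := lin_on_fsum subA linl Am (part_eval_finite x fc).
split => //; apply: eq_fsbigr => m _; rewrite sph_part_map.
rewrite -[_ *: _]addr0 linl ?(lin_on0 subA linl) ?addr0 //.
by rewrite /sph_part; case: ifP.
Qed.

End SphericalMaps.

(** * Configurations of points *)

Section Configurations.
Variables (R : realType) (d : nat).

Lemma row_rV (y : 'rV[R]_d) i : row i y = y.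
Proof. by apply/rowP => j; rewrite mxE ord1. Qed.

Lemma conf_cons m (y : 'rV[R]_d) (A : 'M[R]_(m, d)) :
  conf (col_mx y A) <-> conf A /\ forall k, row k A != y.
Proof.
split=> [inj|[injA yA]].
  split=> [i j ij|k].
    by apply: (@rshift_inj 1 m); apply: inj; rewrite !rowKd.
  apply/eqP => Ay; suff /inj : row (lshift m 0) (col_mx y A) =
    row (rshift 1 k) (col_mx y A) by [].
  by rewrite rowKu rowKd Ay row_rV.
move=> i j; case: (split_ordP i) => i' ->; case: (split_ordP j) => j' ->;
  rewrite ?rowKu ?rowKd ?row_rV.
- by rewrite (ord1 i') (ord1 j').
- by move/esym/eqP; rewrite (negbTE (yA _)).
- by move/eqP; rewrite (negbTE (yA _)).
- by move/injA => ->.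
Qed.

Lemma conf1 (y : 'rV[R]_d) : conf y.
Proof. by move=> i j _; rewrite (ord1 i) (ord1 j). Qed.

Lemma conf_pair (y z : 'rV[R]_d) : conf (pair_conf y z) <-> y != z.
Proof.
split=> [/conf_cons[_ /(_ 0)]|yz]; first by rewrite row_rV eq_sym.
apply/conf_cons; split=> [|k]; first exact: conf1.
by rewrite row_rV eq_sym.
Qed.

End Configurations.

(** * Weight spaces of a compact module *)

Section WeightSpaces.
Variables (R : realType) (d : nat) (H : lmodType R[i]) (M : conf_module d H).

Lemma submod_weight_space D : submod (weight_space M D).
Proof.
split=> [|k a b aD bD]; rewrite /weight_space /=.
  have := act_linear_r M (eltD R d) (-1) 0 0.
  by rewrite !scaleN1r oppr0 addr0 addNr scaler0.
by rewrite act_linear_r aD bD scalerDr !scalerA mulrC.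
Qed.

Lemma pairing_lin (u : Hdual M) (f g : R -> H) (k : R[i]) :
  Hbar M f -> Hbar M g ->
  pairing u (fun D => k *: f D + g D) = k *: pairing u f + pairing u g.
Proof.
move=> Hf Hg.
have supp h : Hbar M h -> finite_set [set D | dual_fun u D (h D) != 0].
  by move=> Hh; apply: sub_finite_set (dual_finite u) => D uD; exists (h D).
rewrite -fsum_linear; [|exact: supp..].
by apply: eq_fsbigr => D _; rewrite dual_linear.
Qed.

Hypothesis cM : compact_module M.

Lemma compP a : is_decomp M a (Defs.comp M a).
Proof.
have [/(_ a)[f [fa _]] _ _] := cM.
exact: (xgetPex (fun=> 0) (ex_intro _ f fa)).
Qed.

Lemma comp_weight a D : weight_space M D (Defs.comp M a D).
Proof. by have [] := compP a. Qed.

(** The decomposition into weight vectors is unique. *)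
Lemma comp_linear k a b D :
  Defs.comp M (k *: a + b) D = k *: Defs.comp M a D + Defs.comp M b D.
Proof.
have [/(_ (k *: a + b))[f [_ uf]] _ _] := cM.
have [aw af asum] := compP a; have [bw bf bsum] := compP b.
suff dec : is_decomp M (k *: a + b)
    (fun D => k *: Defs.comp M a D + Defs.comp M b D).
  by rewrite -(uf _ (compP _)) (uf _ dec).
split=> [D'||]; first by have [_] := submod_weight_space D'; apply.
  exact: finite_set_comb.
by rewrite fsum_linear // -asum -bsum.
Qed.

Lemma comp_sum a : exists s : seq R, a = \sum_(D <- s) Defs.comp M a D.
Proof.
have [aw /finite_set_fset[s fs] asum] := compP a.
by exists s; rewrite {1}asum (fsum_fset fs).
Qed.

Lemma lin_on_comp D : lin_on [set: H] (fun a => Defs.comp M a D).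
Proof. by move=> k a b _ _; exact: comp_linear. Qed.

Lemma edim_weight_space D : (edim (weight_space M D) < +oo)%E.
Proof.
have [_ /(_ D) + _] := cM; apply: le_lt_trans; apply: esum_ge.
have fD : finite_set [set D] by exact: finite_set1.
exists [set D]; first by split => // D' ->/=.
by rewrite fsbig_set1.
Qed.

(** Weight spaces of a compact module have finite dimension by the second axiom
    of compactness. *)
Lemma weight_separation D a b : weight_space M D a -> weight_space M D b ->
  (forall l : H -> R[i]^o, lin_on (weight_space M D) l -> l a = l b) -> a = b.
Proof.
move=> aD bD lab; have subD := submod_weight_space D.
have abE : a - b = (-1) *: b + a by rewrite scaleN1r addrC.
apply/eqP; rewrite -subr_eq0; apply/eqP.
apply: (lin_on_separates subD (edim_weight_space D)) => [|l ll].
  by rewrite abE; apply: (proj2 subD).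
by rewrite abE ll // scaleN1r lab // addNr.
Qed.

End WeightSpaces.

(** * The vertex operator is the two-point map at (x, 0) *)

Section VertexEvaluation.
Variables (R : realType) (d : nat) (H : lmodType R[i]) (S : cc_system d H).
Variables (Y : H -> H -> sph_mon R d -> H) (hY : is_vertex_operator S Y).
Variables (x : 'rV[R]_d) (x0 : x != 0).

Let corr2 a b D := corr S (pair_conf x 0) (fcat (fun=> a) (fun=> b)) D.

Lemma corr2_weight a b D : weight_space S D (corr2 a b D).
Proof. by apply: corr_Hbar => //; apply/conf_pair. Qed.

Lemma corr2_linear_l k a a' b D :
  corr2 (k *: a + a') b D = k *: corr2 a b D + corr2 a' b D.
Proof.
have E c : fcat (fun=> c) (fun=> b) =
    update (fcat (fun=> a) (fun=> b)) (lshift 1 (0 : 'I_1)) c.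
  apply/funext => i; rewrite /update /fcat; case: split_ordP => j ->.
    by rewrite (ord1 j) eqxx.
  by rewrite eq_rlshift.
rewrite /corr2 (E (k *: a + a')) corr_multilinear //; last exact/conf_pair.
by rewrite -(E a) -(E a').
Qed.

Lemma corr2_linear_r k a b b' D :
  corr2 a (k *: b + b') D = k *: corr2 a b D + corr2 a b' D.
Proof.
have E c : fcat (fun=> a) (fun=> c) =
    update (fcat (fun=> a) (fun=> b)) (rshift 1 (0 : 'I_1)) c.
  apply/funext => i; rewrite /update /fcat; case: split_ordP => j ->.
    by rewrite eq_lrshift.
  by rewrite (ord1 j) eqxx.
rewrite /corr2 (E (k *: b + b')) corr_multilinear //; last exact/conf_pair.
by rewrite -(E b) -(E b').
Qed.

Let cS : compact_module S := cc_compact S.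

Definition vertex_part D a b lambda : H :=
  part_eval (fun m => Defs.comp S (Y a b m) D) lambda x.

Lemma vertex_finite a b lambda : finite_coeffs (sph_part (Y a b) lambda).
Proof. by have [/(_ a b)[+ _] _ _] := hY; apply. Qed.

Lemma vertex_finite_comp D a b lambda :
  finite_coeffs (sph_part (fun m => Defs.comp S (Y a b m) D) lambda).
Proof.
exact: (finite_coeffs_map (submodT H) (lin_on_comp cS D))
  (vertex_finite a b lambda).
Qed.

Lemma vertex_part_comp D a b lambda :
  vertex_part D a b lambda = Defs.comp S (part_eval (Y a b) lambda x) D.
Proof.
by have [] := part_eval_map (submodT H) (lin_on_comp cS D)
  (fun=> I) x (vertex_finite a b lambda).
Qed.

Lemma vertex_part_linear_l D k a a' b lambda :
  vertex_part D (k *: a + a') b lambda =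
    k *: vertex_part D a b lambda + vertex_part D a' b lambda.
Proof.
have [_ [bil _] _] := hY.
rewrite !vertex_part_comp -(comp_linear cS).
rewrite -part_eval_linear; [|exact: vertex_finite..].
congr Defs.comp; apply: part_eval_eq (bil k a a' b lambda) => //.
  exact: vertex_finite.
by apply: finite_coeffs_comb; exact: vertex_finite.
Qed.

Lemma vertex_part_linear_r D k a b b' lambda :
  vertex_part D a (k *: b + b') lambda =
    k *: vertex_part D a b lambda + vertex_part D a b' lambda.
Proof.
have [_ [_ bil] _] := hY.
rewrite !vertex_part_comp -(comp_linear cS).
rewrite -part_eval_linear; [|exact: vertex_finite..].
congr Defs.comp; apply: part_eval_eq (bil k a b b' lambda) => //.
  exact: vertex_finite.
by apply: finite_coeffs_comb; exact: vertex_finite.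
Qed.

Section Homogeneous.
Variables (D0 D1 D2 : R) (a b : H).
Hypotheses (aD1 : weight_space S D1 a) (bD2 : weight_space S D2 b).

Lemma vertex_part_functional (l : H -> R[i]^o) lambda :
  lin_on (weight_space S D0) l ->
  l (vertex_part D0 a b lambda) =
    part_eval (fun m => l (Defs.comp S (Y a b m) D0) : R[i]^o) lambda x.
Proof.
move=> ll; have subD := submod_weight_space S D0.
by have [_ ->] := part_eval_map subD ll (fun m => comp_weight cS _ _) x
  (vertex_finite_comp D0 a b lambda).
Qed.

(** Every functional l on the D0-weight space sends the vertex operator to
    something equivalent to |x|^(D0 - D1 - D2) p(x / |x|), whose other degrees
    evaluate to 0, and to the two-point map in total; functionals separate. *)
Lemma vertex_part_homog lambda :
  vertex_part D0 a b lambda =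
    if lambda == D0 - D1 - D2 then corr2 a b D0 else 0.
Proof.
have subD := submod_weight_space S D0.
apply: (@weight_separation _ _ _ _ cS D0) => [||l ll].
- by rewrite vertex_part_comp; exact: comp_weight.
- by case: ifP => _; [exact: corr2_weight|exact: (proj1 subD)].
have [_ [_ _]] := (hY); move=> /(_ D0 D1 D2 l a b ll aD1 bD2)[[c fc eq_fc] fx].
have fin mu : finite_coeffs (sph_part
    (fun m => l (Defs.comp S (Y a b m) D0) : R[i]^o) mu).
  exact: (finite_coeffs_map subD ll (vertex_finite_comp D0 a b mu)).
have part0 mu : mu != D0 - D1 - D2 -> part_eval
    (fun m => l (Defs.comp S (Y a b m) D0) : R[i]^o) mu x = 0.
  move=> mu0; rewrite -[RHS](part_eval_homog c x mu0).
  apply: part_eval_eq (eq_fc mu) => //.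
  exact: finite_coeffs_homog.
rewrite (vertex_part_functional _ ll).
case: ifPn => [/eqP ->|/part0 ->]; last by rewrite (lin_on0 subD ll).
rewrite -[RHS]fx // sph_evalE -(@fsbig_widen _ _ _ _ [set D0 - D1 - D2]) //.
  by rewrite fsbig_set1.
by move=> mu [_ /eqP mu0]; exact: part0.
Qed.

End Homogeneous.

(** Both sides are bilinear in (a, b), and so is the finiteness of the set of
    contributing degrees: decompose a and b into weight vectors. *)
Lemma vertex_part_sum D a b :
  finite_set [set lambda | vertex_part D a b lambda != 0] /\
  \sum_(lambda \in [set: R]) vertex_part D a b lambda = corr2 a b D.
Proof.
pose P a b := finite_set [set lambda | vertex_part D a b lambda != 0] /\
  \sum_(lambda \in [set: R]) vertex_part D a b lambda = corr2 a b D.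
have Pl k a1 a2 b' : P a1 b' -> P a2 b' -> P (k *: a1 + a2) b'.
  move=> [f1 s1] [f2 s2].
  have E : vertex_part D (k *: a1 + a2) b' = fun t =>
      k *: vertex_part D a1 b' t + vertex_part D a2 b' t.
    by apply/funext => t; exact: vertex_part_linear_l.
  rewrite /P E fsum_linear // s1 s2 corr2_linear_l.
  by split=> //; exact: finite_set_comb.
have Pr k a' b1 b2 : P a' b1 -> P a' b2 -> P a' (k *: b1 + b2).
  move=> [f1 s1] [f2 s2].
  have E : vertex_part D a' (k *: b1 + b2) = fun t =>
      k *: vertex_part D a' b1 t + vertex_part D a' b2 t.
    by apply/funext => t; exact: vertex_part_linear_r.
  rewrite /P E fsum_linear // s1 s2 corr2_linear_r.
  by split=> //; exact: finite_set_comb.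
have Phom D1 D2 a' b' : weight_space S D1 a' -> weight_space S D2 b' -> P a' b'.
  move=> a'D b'D; split.
    apply: sub_finite_set (finite_set1 (D - D1 - D2)) => t /=.
    rewrite (vertex_part_homog _ a'D b'D).
    by case: ifPn => [/eqP //|_]; rewrite eqxx.
  rewrite -(@fsbig_widen _ _ _ _ [set D - D1 - D2]) //.
    by rewrite fsbig_set1 (vertex_part_homog _ a'D b'D) eqxx.
  by move=> t [_ /eqP tD]; rewrite /= (vertex_part_homog _ a'D b'D) (negbTE tD).
have P0 D1 a' : weight_space S D1 a' -> P a' b.
  move=> a'D; have [s ->] := comp_sum cS b.
  elim: s => [|D2 s IH]; rewrite ?big_nil ?big_cons.
    by apply: Phom a'D (proj1 (submod_weight_space S 0)).
  rewrite -[Defs.comp _ _ _]scale1r; apply: Pr IH.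
  exact: Phom a'D (comp_weight cS _ _).
have [s ->] := comp_sum cS a; rewrite -/(P _ _).
elim: s => [|D1 s IH]; rewrite ?big_nil ?big_cons.
  by apply: P0 (proj1 (submod_weight_space S 0)).
rewrite -[Defs.comp _ _ _]scale1r; apply: Pl IH.
exact: P0 (comp_weight cS _ _).
Qed.

(** The identification that turns the two series of the theorem into cluster
    expansions. *)
Lemma pr_vertexE D a b : pr_vertex S Y D a x b = corr2 a b D.
Proof.
by rewrite /pr_vertex sph_evalE; have [_ <-] := vertex_part_sum D a b.
Qed.

Lemma pairing_vertexE (u : Hdual S) a b :
  pairing_vertex Y u a x b = pairing u (corr2 a b).
Proof.
rewrite /pairing_vertex sph_evalE.
have [s us] := finite_set_fset (dual_finite u).
have pE (f : R -> H) : Hbar S f ->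
    pairing u f = \sum_(D <- s) dual_fun u D (f D).
  by move=> Hf; apply: fsum_fset => D uD; apply: us; exists (f D).
have lin_u : lin_on [set: H] (fun h => pairing u (Defs.comp S h) : R[i]^o).
  move=> k v w _ _; rewrite -pairing_lin; [|exact: comp_weight..].
  by congr pairing; apply/funext => D; exact: comp_linear.
have partE lambda :
    part_eval (fun m => pairing u (Defs.comp S (Y a b m)) : R[i]^o) lambda x =
    \sum_(D <- s) dual_fun u D (vertex_part D a b lambda).
  have [_ <-] := part_eval_map (submodT H) lin_u (fun=> I) x
    (vertex_finite a b lambda).
  rewrite pE; last exact: comp_weight.
  by apply: eq_bigr => D _; rewrite vertex_part_comp.
under eq_fsbigr do rewrite partE.
rewrite pE; last by move=> D; exact: corr2_weight.
have linD D : submod (weight_space S D) := submod_weight_space S D.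
have vw D lambda : weight_space S D (vertex_part D a b lambda).
  by rewrite vertex_part_comp; exact: comp_weight.
have sumD D := lin_on_fsum (linD D) (dual_linear u (D := D)) (vw D)
  (proj1 (vertex_part_sum D a b)).
rewrite fsum_exchange => [|D]; last first.
  apply: sub_finite_set (proj1 (vertex_part_sum D a b)) => t /=.
  apply: contra_neq => ->.
  exact: (lin_on0 (linD D) (dual_linear u (D := D))).
apply: eq_bigr => D _.
by rewrite -(proj2 (sumD D)) (proj2 (vertex_part_sum D a b)).
Qed.

End VertexEvaluation.

(** * Local compactness and local uniform convergence *)

Section MatrixTopology.
Variables (R : realType) (n d : nat).

Lemma continuous_mx (T : topologicalType) (f : T -> 'M[R]_(n, d)) :
  (forall i j, continuous (fun t => f t i j)) -> continuous f.
Proof.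
move=> cf t A [P nP sPA].
suff : \forall s \near t, forall i j, P i j (f s i j).
  by apply: filterS => s Ps; exact: sPA.
by apply: filter_forall => i; apply: filter_forall => j; exact: cf.
Qed.

(** The neighbourhoods of a matrix are defined entry by entry, so a box with
    entrywise radii fits into U; it is compact as the image of a box of row
    vectors. *)
Lemma locally_compact_mx (z : 'M[R]_(n, d)) (U : set 'M[R]_(n, d)) :
  nbhs z U -> exists V, [/\ nbhs z V, compact V & V `<=` U].
Proof.
move=> [P nP sPU].
have ball_P ij : exists e : {posnum R},
    forall t, `|z ij.1 ij.2 - t| <= e%:num -> P ij.1 ij.2 t.
  have /nbhs_closedballP[e eP] := nP ij.1 ij.2.
  by exists e => t zt; apply: eP; rewrite closed_ballE.
have [e eP] := choice ball_P.
pose I i j := `[z i j - (e (i, j))%:num, z i j + (e (i, j))%:num]%classic.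
pose V := [set M : 'M[R]_(n, d) | forall i j, I i j (M i j)].
exists V; split.
- exists I => // i j; rewrite /I.
  have : (z i j) \in `](z i j - (e (i, j))%:num), (z i j + (e (i, j))%:num)[.
    by rewrite in_itv /= ltrBlDr !ltrDl !gt0.
  move=> /near_in_itvoo; apply: filterS => t; rewrite /= !in_itv /=.
  by move=> /andP[/ltW -> /ltW ->].
- pose B (k : 'I_(n * d)) :=
    `[mxvec z 0 k - (mxvec (\matrix_(i, j) (e (i, j))%:num)) 0 k,
      mxvec z 0 k + (mxvec (\matrix_(i, j) (e (i, j))%:num)) 0 k]%classic.
  have -> : V = vec_mx @` [set v : 'rV[R]_(n * d) | forall k, B k (v ord0 k)].
    apply/seteqP; split=> [M VM|M [v Bv <-] i j].
      exists (mxvec M); last exact: mxvecK.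
      move=> k; case/mxvec_indexP: k => i j.
      by rewrite /B !mxvecE mxE; exact: VM.
    by have := Bv (mxvec_index i j); rewrite /B !mxvecE !mxE.
  apply: continuous_compact.
    apply: continuous_subspaceT; apply: continuous_mx => i j.
    under eq_fun do rewrite mxE; exact: coord_continuous.
  by apply: rV_compact => k; exact: segment_compact.
- move=> M VM; apply: sPU => i j; apply: (eP (i, j)) => /=.
  by have := VM i j; rewrite /I /= in_itv /= distrC -ler_distlC distrC.
Qed.

End MatrixTopology.

Section LocallyUniform.
Variables (R : realType) (n d : nat) (T : topologicalType).

(** A compact neighbourhood of z in U has a compact image in W. *)
Lemma cvg_loc_unif_pullback (U : set 'M[R]_(n, d)) (W : set T)
    (f : R -> 'M[R]_(n, d) -> R[i]^o) (f0 : 'M[R]_(n, d) -> R[i]^o)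
    (g : R -> T -> R[i]^o) (g0 : T -> R[i]^o) (Phi : 'M[R]_(n, d) -> T) :
  open U -> continuous Phi -> (forall z, U z -> W (Phi z)) ->
  (forall D z, U z -> f D z = g D (Phi z)) ->
  (forall z, U z -> f0 z = g0 (Phi z)) ->
  cvg_compactly W g g0 -> cvg_loc_unif U f f0.
Proof.
move=> oU cPhi UW fg fg0 cvg_g z Uz.
have [V [zV cV VU]] := locally_compact_mx (open_nbhs_nbhs (conj oU Uz)).
exists V => // A /uniform_nbhs[E [entE sEA]].
have cPV : compact (Phi @` V).
  by apply: continuous_compact => //; exact: continuous_subspaceT.
have PVW : Phi @` V `<=` W by move=> _ [y Vy <-]; apply/UW/VU.
have nE : nbhs (g0 : {uniform` Phi @` V -> R[i]^o})
    [set h | forall y, (Phi @` V) y -> E (g0 y, h y)].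
  by apply/(uniform_nbhs (A := Phi @` V) g0); exists E; split.
have gN : \forall N \near +oo, forall y, (Phi @` V) y -> E (g0 y, psum g N y).
  exact: cvg_g cPV PVW _ nE.
suff : \forall N \near +oo, A (psum f N) by [].
near=> N.
have gNy : forall y, (Phi @` V) y -> E (g0 y, psum g N y) by near: N.
apply: sEA => y [Vy Uy]; rewrite fg0 //.
have -> : psum f N y = psum g N (Phi y) by apply: eq_fsbigr => D _; exact: fg.
by apply: gNy; exists y.
Unshelve. all: by end_near. Qed.

End LocallyUniform.

Section EnormTopology.
Variables (R : realType) (d : nat) (T : topologicalType).

Lemma continuous_enorm (f : T -> 'rV[R]_d) :
  continuous f -> continuous (fun t => enorm (f t)).
Proof.
move=> cf t.
apply: (@continuous_comp _ _ _ (fun t => \sum_i f t 0 i ^+ 2));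
  last exact: sqrt_continuous.
move: t; apply: continuous_big => [|i _ t]; first exact: add_continuous.
apply: (@continuous_comp _ _ _ _ (fun y : R => y ^+ 2));
  last exact: exprn_continuous.
apply: (@continuous_comp _ _ _ f (fun v : 'rV[R]_d => v 0 i)); first exact: cf.
exact: coord_continuous.
Qed.

Lemma open_lt_continuous (f g : T -> R) : continuous f -> continuous g ->
  open [set t | f t < g t].
Proof.
move=> cf cg; rewrite openE => t /= ft.
have : (fun s => g s - f s) @ t --> g t - f t.
  by apply: cvgB; [exact: cg|exact: cf].
move=> /cvgr_gt/(_ 0); rewrite subr_gt0 => /(_ ft).
by apply: filterS => s; rewrite subr_gt0.
Qed.

Lemma open_annulus (f g : T -> 'rV[R]_d) : continuous f -> continuous g ->
  open [set t | 0 < enorm (f t) < enorm (g t)].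
Proof.
move=> cf cg.
rewrite (_ : mkset _ = [set t | 0 < enorm (f t)] `&`
    [set t | enorm (f t) < enorm (g t)]); last first.
  by apply/seteqP; split=> t /= => [/andP|/andP].
apply: openI; apply: open_lt_continuous; try exact: continuous_enorm.
exact: cst_continuous.
Qed.

End EnormTopology.

(** * Analyticity on coordinate subspaces *)

Lemma abs_summable_reindex (R : realType) (T1 T2 : choiceType) (k : T1 -> T2)
    (G : T2 -> R[i]) :
  injective k -> abs_summable G -> abs_summable (fun t => G (k t)).
Proof.
move=> kinj; apply: le_lt_trans; apply: ge_ereal_sup => _ [A [fA _] <-].
apply: esum_ge; exists (k @` A); first by split=> //; exact: finite_image.
by rewrite fsbig_image // => a b _ _; exact: kinj.
Qed.

Section Reindexing.
Variables (R : realType) (T T' : choiceType) (h : T -> T') (F : T' -> R[i]).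
Hypotheses (h_inj : injective h) (F0 : forall t, ~ range h t -> F t = 0).

Lemma has_sum_reindex s : has_sum F s -> has_sum (fun t => F (h t)) s.
Proof.
move=> [sF limF]; split=> [|e e0]; first exact: abs_summable_reindex.
have [A0 fA0 lim0] := limF e e0.
exists (h @^-1` A0).
  by apply: finite_preimage => // a b _ _; exact: h_inj.
move=> A fA A0A.
rewrite -(@fsbig_image _ _ _ _ _ A h F) => [|a b _ _]; last exact: h_inj.
rewrite (@fsbig_widen _ _ _ _ (h @` A) (h @` A `|` A0)) => [||t [[//|A0t] nAt]].
- apply: lim0; first by rewrite finite_setU; split=> //; exact: finite_image.
  exact: subsetUr.
- exact: subsetUl.
- apply: F0 => -[a _ ha]; apply: nAt; exists a => //.
  by apply: A0A; rewrite /= ha.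
Qed.

End Reindexing.

Section AnalyticRestriction.
Variables (R : realType) (d n p : nat) (iota : 'I_n -> 'I_p).
Hypothesis iota_inj : injective iota.
Variable g : 'M[R]_(n, d) -> 'M[R]_(p, d).
Hypotheses (g_in : forall y k j, g y (iota k) j = y k j)
  (g_out : forall y y' i j, i \notin codom iota -> g y i j = g y' i j).

Let back (ij : 'I_p * 'I_d) : option ('I_n * 'I_d) :=
  omap (fun k => (k, ij.2)) [pick k | iota k == ij.1].

Let extend (be : {ffun 'I_n * 'I_d -> nat}) : {ffun 'I_p * 'I_d -> nat} :=
  [ffun ij => oapp be 0%N (back ij)].

Let backK k j : back (iota k, j) = Some (k, j).
Proof.
rewrite /back; case: pickP => [k' /eqP /iota_inj -> //|/(_ k)].
by rewrite eqxx.
Qed.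

Let back_out i j : i \notin codom iota -> back (i, j) = None.
Proof.
move=> ci; rewrite /back; case: pickP => //= k /eqP ki.
by rewrite -ki codom_f in ci.
Qed.

Let extend_inj : injective extend.
Proof.
move=> be be' /ffunP E; apply/ffunP => -[k j].
by have := E (iota k, j); rewrite !ffunE backK.
Qed.

(** The rows of [g y] indexed by [iota] are those of y and the others are
    constant.  In the power series at [g x], a monomial that involves a constant
    row vanishes identically, and the others are the monomials in y - x. *)
Lemma analytic_at_restriction (f : 'M[R]_(p, d) -> R[i]) x :
  analytic_at f (g x) -> analytic_at (fun y => f (g y)) x.
Proof.
move=> [c [r [r0 fc]]]; exists (fun be => c (extend be)), r; split=> // y yx.
have gyx : `|g y - g x| < r.
  have : ball x r y by rewrite -ball_normE /= distrC.
  rewrite distrC => Bxy; suff : ball (g x) r (g y) by rewrite -ball_normE.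
  split=> // i j; case: (boolP (i \in codom iota)) => [/codomP[k ->]|ci].
    by rewrite !g_in; case: Bxy.
  by rewrite (g_out y x) //; exact: ballxx.
pose F al := c al * (\prod_q (g y q.1 q.2 - g x q.1 q.2) ^+ al q)%:C.
have F0 al : ~ range extend al -> F al = 0.
  move=> nal; have [[i j] /andP[ci al0]] : exists q : 'I_p * 'I_d,
      (q.1 \notin codom iota) && (al q != 0%N).
    apply: contrapT => nq; apply: nal.
    exists [ffun kj => al (iota kj.1, kj.2)] => //.
    apply/ffunP => -[i j]; rewrite ffunE.
    case: (boolP (i \in codom iota)) => [/codomP[k ->]|ci].
      by rewrite backK /= ffunE.
    rewrite back_out //=; apply/esym/eqP; apply: contrapT => al0; apply: nq.
    by exists (i, j) => /=; rewrite ci; apply/negP.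
  rewrite /F (bigD1 (i, j)) //= (g_out y x) // subrr expr0n (negbTE al0).
  by rewrite mul0r rmorph0 mulr0.
have := has_sum_reindex extend_inj F0 (fc _ gyx).
congr has_sum; apply/funext => be; rewrite /F; congr (_ * _%:C).
rewrite (bigID (fun q => q.1 \in codom iota)) /= [X in _ * X]big1 ?mulr1.
  rewrite (reindex_omap (fun kj : 'I_n * 'I_d => (iota kj.1, kj.2)) back).
    apply: eq_big => [[k j]|[k j] _] /=; first by rewrite codom_f backK eqxx.
    by rewrite ffunE backK !g_in.
  by move=> [i j] /= /codomP[k ->]; rewrite backK.
by move=> [i j] /= ci; rewrite ffunE back_out // expr0.
Qed.

End AnalyticRestriction.

(** * Two- and three-point maps *)

Section Triples.
Variables (R : realType) (d : nat).

Definition triple_conf (x y z : 'rV[R]_d) : 'M[R]_(1 + (1 + 1), d) :=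
  col_mx x (pair_conf y z).

Lemma conf_triple (x y z : 'rV[R]_d) :
  x != y -> x != z -> y != z -> conf (triple_conf x y z).
Proof.
move=> xy xz yz; apply/conf_cons; split; first exact/conf_pair.
by move=> k; case: (split_ordP k) => i ->; rewrite ?rowKu ?rowKd row_rV eq_sym.
Qed.

(** The second point of the cluster sits at its centre w, so that the condition
    on it reads |x - w| > 0, which follows from the one on y. *)
Lemma cluster_dom_pair (x w y : 'rV[R]_d) : 0 < enorm y < enorm (x - w) ->
  cluster_dom (n := 1) (pair_conf x w, pair_conf y 0).
Proof.
move=> /andP[y0 yxw]; have xw := lt_trans y0 yxw.
rewrite enorm_gt0 in y0; rewrite enorm_gt0 subr_eq0 in xw.
split=> /= [||k l]; [exact/conf_pair..|].
rewrite /pair_conf col_mxKu col_mxKd row_rV.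
case: (split_ordP l) => i ->; rewrite ?rowKu ?rowKd row_rV //.
by rewrite enorm0 enorm_gt0 subr_eq0.
Qed.

Lemma cluster_conf_pair (x w y : 'rV[R]_d) :
  cluster_conf (n := 1) (pair_conf x w, pair_conf y 0) =
    triple_conf x (w + y) w.
Proof.
rewrite /cluster_conf /triple_conf /pair_conf /= col_mxKu col_mxKd.
congr col_mx; apply/row_matrixP => i; rewrite rowK.
case: (split_ordP i) => k ->; rewrite ?rowKu ?rowKd !row_rV //.
by rewrite addr0.
Qed.

Variables (H : lmodType R[i]) (S : cc_system d H).

Definition pair_fields (a b : H) : 'I_(1 + 1) -> H := fcat (fun=> a) (fun=> b).

Definition triple_fields (a b c : H) : 'I_(1 + (1 + 1)) -> H :=
  fcat (fun=> a) (pair_fields b c).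

Lemma fcat_lshift n m (a : 'I_n -> H) (b : 'I_m -> H) k :
  fcat a b (lshift m k) = a k.
Proof.
rewrite /fcat; case: split_ordP => j /eqP; last by rewrite eq_lrshift.
by rewrite eq_lshift => /eqP ->.
Qed.

Lemma fcat_rshift n m (a : 'I_n -> H) (b : 'I_m -> H) k :
  fcat a b (rshift n k) = b k.
Proof.
rewrite /fcat; case: split_ordP => j /eqP; first by rewrite eq_rlshift.
by rewrite eq_rshift => /eqP ->.
Qed.

Lemma corr_reorder n (x x' : 'M[R]_(n, d)) (a a' : 'I_n -> H) (s : 'S_n) :
  (0 < n)%N -> conf x -> (forall i, row i x' = row (s i) x) ->
  (forall i, a' i = a (s i)) -> corr S x a = corr S x' a'.
Proof.
move=> n0 cx xs /funext ->; rewrite (corr_perm S a s n0 cx); congr corr.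
apply/row_matrixP => i; rewrite xs; by apply/rowP => j; rewrite !mxE.
Qed.

Lemma corr_pair_swap (x y : 'rV[R]_d) a b : x != y ->
  corr S (pair_conf x y) (pair_fields a b) =
  corr S (pair_conf y x) (pair_fields b a).
Proof.
move=> /conf_pair xy.
apply: (corr_reorder (s := tperm (lshift 1 0) (rshift 1 0)) _ xy) => // i;
  case: (split_ordP i) => k ->; rewrite (ord1 k) ?tpermL ?tpermR.
- by rewrite rowKu rowKd !row_rV.
- by rewrite rowKu rowKd !row_rV.
- by rewrite /pair_fields fcat_lshift fcat_rshift.
- by rewrite /pair_fields fcat_lshift fcat_rshift.
Qed.

Lemma corr_triple_swap12 (x y z : 'rV[R]_d) a b c :
  conf (triple_conf x y z) ->
  corr S (triple_conf x y z) (triple_fields a b c) =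
  corr S (triple_conf y x z) (triple_fields b a c).
Proof.
move=> cxyz; apply: (corr_reorder
  (s := tperm (lshift (1 + 1) 0) (rshift 1 (lshift 1 0))) _ cxyz) => // i;
  (case: (split_ordP i) => k ->; last case: (split_ordP k) => {}k ->);
  rewrite (ord1 k) ?tpermL ?tpermR ?tpermD ?(inj_eq (@rshift_inj _ _))
    ?eq_lrshift //;
  by rewrite ?rowKu ?rowKd ?rowKu ?rowKd ?row_rV // /triple_fields /pair_fields
    ?fcat_lshift ?fcat_rshift ?fcat_lshift ?fcat_rshift.
Qed.

Lemma corr_triple_swap23 (x y z : 'rV[R]_d) a b c :
  conf (triple_conf x y z) ->
  corr S (triple_conf x y z) (triple_fields a b c) =
  corr S (triple_conf x z y) (triple_fields a c b).
Proof.
move=> cxyz; apply: (corr_reorder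
  (s := tperm (rshift 1 (lshift 1 0)) (rshift 1 (rshift 1 0))) _ cxyz) => // i;
  (case: (split_ordP i) => k ->; last case: (split_ordP k) => {}k ->);
  rewrite (ord1 k) ?tpermL ?tpermR ?tpermD ?eq_rlshift //;
  by rewrite ?rowKu ?rowKd ?rowKu ?rowKd ?row_rV // /triple_fields /pair_fields
    ?fcat_lshift ?fcat_rshift ?fcat_lshift ?fcat_rshift.
Qed.

Variables (Y : H -> H -> sph_mon R d -> H) (hY : is_vertex_operator S Y).
Implicit Types (u : Hdual S) (a b c : H).

Definition cluster_term (u : Hdual S) (a b c : H) (D : R)
    (z : 'M[R]_(1 + 1, d) * 'M[R]_(1 + 1, d)) : R[i]^o :=
  pairing u (corr S z.1 (pair_fields a (corr S z.2 (pair_fields b c) D))).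

Lemma product_termE u a b c D (x1 x2 : 'rV[R]_d) : x1 != 0 -> x2 != 0 ->
  product_term Y u a b c D x1 x2 =
    cluster_term u a b c D (pair_conf x1 0, pair_conf x2 0).
Proof.
move=> x10 x20.
by rewrite /product_term (pairing_vertexE hY) // (pr_vertexE hY).
Qed.

(** The cluster axiom expands the last argument, whereas the iterate expands the
    first: hence the exchange of the points 0 and x2. *)
Lemma iterate_termE u a b c D (x0 x2 : 'rV[R]_d) : x0 != 0 -> x2 != 0 ->
  iterate_term Y u a b c D x0 x2 =
    cluster_term u c a b D (pair_conf 0 x2, pair_conf x0 0).
Proof.
move=> x00 x20.
rewrite /iterate_term (pairing_vertexE hY) // (pr_vertexE hY) //.
by rewrite /cluster_term /= -corr_pair_swap.
Qed.

Lemma cluster_term_cvg u a b c :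
  (forall z, cluster_dom (n := 1) z ->
    abs_summable (cluster_term u a b c ^~ z)) /\
  cvg_compactly (cluster_dom (n := 1) (m := 1 + 1)) (cluster_term u a b c)
    (fun z => pairing u (corr S (cluster_conf z) (triple_fields a b c))).
Proof.
exact: (@corr_cluster _ _ _ S 1 (1 + 1) (fun=> a) (pair_fields b c) u).
Qed.

Lemma product_summable u a b c (x1 x2 : 'rV[R]_d) :
  0 < enorm x2 < enorm x1 ->
  abs_summable (fun D => product_term Y u a b c D x1 x2).
Proof.
move=> x21; have /andP[x20 x2lt] := x21; have x10 := lt_trans x20 x2lt.
rewrite !enorm_gt0 in x20 x10.
under eq_fun do rewrite product_termE //.
apply: (proj1 (cluster_term_cvg u a b c)); apply: cluster_dom_pair.
by rewrite subr0.
Qed.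

Lemma iterate_summable u a b c (x0 x2 : 'rV[R]_d) :
  0 < enorm x0 < enorm x2 ->
  abs_summable (fun D => iterate_term Y u a b c D x0 x2).
Proof.
move=> x02; have /andP[x00 x0lt] := x02; have x20 := lt_trans x00 x0lt.
rewrite !enorm_gt0 in x00 x20.
under eq_fun do rewrite iterate_termE //.
apply: (proj1 (cluster_term_cvg u c a b)); apply: cluster_dom_pair.
by rewrite sub0r enormN.
Qed.

Definition three_point u a b c (z : 'M[R]_(1 + 1, d)) : R[i]^o :=
  pairing u
    (corr S (triple_conf (usubmx z) (dsubmx z) 0) (triple_fields a b c)).

Lemma three_point_analytic u a b c :
  analytic_on (@Y2 R d) (three_point u a b c).
Proof.
move=> z [z1 z2 z12].
have := corr_analytic u (triple_fields a b c) isT (conf_triple z12 z1 z2).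
pose iota : 'I_(1 + 1) -> 'I_(1 + (1 + 1)) :=
  widen_ord (isT : 1 + 1 <= 1 + (1 + 1))%N.
pose g (y : 'M[R]_(1 + 1, d)) := triple_conf (usubmx y) (dsubmx y) 0.
have iota0 : iota (lshift 1 0) = lshift (1 + 1) 0 by apply/val_inj.
have iota1 : iota (rshift 1 0) = rshift 1 (lshift 1 0) by apply/val_inj.
apply: (@analytic_at_restriction _ _ _ _ iota _ g).
- by move=> i j /(congr1 val) /= ij; apply/val_inj.
- move=> y k j; rewrite /g /triple_conf /pair_conf.
  case: (split_ordP k) => k' ->; rewrite (ord1 k') ?iota0 ?iota1;
    by rewrite ?col_mxEu ?col_mxEd ?col_mxEu ?mxE.
- move=> y y' i j; rewrite /g /triple_conf /pair_conf.
  case: (split_ordP i) => k ->; first by rewrite (ord1 k) -iota0 codom_f.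
  case: (split_ordP k) => {}k ->; first by rewrite (ord1 k) -iota1 codom_f.
  by rewrite !col_mxEd !mxE.
Qed.

Lemma continuous_usubmx : continuous (usubmx : 'M[R]_(1 + 1, d) -> 'rV[R]_d).
Proof.
apply: continuous_mx => i j; under eq_fun do rewrite mxE.
exact: coord_continuous.
Qed.

Lemma continuous_dsubmx : continuous (dsubmx : 'M[R]_(1 + 1, d) -> 'rV[R]_d).
Proof.
apply: continuous_mx => i j; under eq_fun do rewrite mxE.
exact: coord_continuous.
Qed.

Lemma continuous_pair_conf (T : topologicalType) (f g : T -> 'rV[R]_d) :
  continuous f -> continuous g -> continuous (fun t => pair_conf (f t) (g t)).
Proof.
move=> cf cg; apply: continuous_mx => i j t.
have cc (h : T -> 'rV[R]_d) k : continuous h ->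
    {for t, continuous (fun s => h s k j)}.
  move=> ch; apply: (@continuous_comp _ _ _ h (fun v : 'rV[R]_d => v k j)).
    exact: ch.
  exact: coord_continuous.
by case: (split_ordP i) => k ->;
  under eq_fun do rewrite /pair_conf ?col_mxEu ?col_mxEd; apply: cc.
Qed.

End Triples.

(** * Convergence of products and iterates *)

Section Convergence.
Variables (R : realType) (d : nat) (H : lmodType R[i]) (S : cc_system d H).
Variables (Y : H -> H -> sph_mon R d -> H) (hY : is_vertex_operator S Y).
Implicit Types (u : Hdual S) (a b c : H).

Lemma cluster_cvg_loc_unif u a b c (U : set 'M[R]_(1 + 1, d))
    (x w y : 'M[R]_(1 + 1, d) -> 'rV[R]_d)
    (f : R -> 'M[R]_(1 + 1, d) -> R[i]^o) (f0 : 'M[R]_(1 + 1, d) -> R[i]^o) :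
  open U -> continuous x -> continuous w -> continuous y ->
  (forall z, U z -> 0 < enorm (y z) < enorm (x z - w z)) ->
  (forall D z, U z -> f D z =
    cluster_term u a b c D (pair_conf (x z) (w z), pair_conf (y z) 0)) ->
  (forall z, U z -> f0 z = pairing u
    (corr S (triple_conf (x z) (w z + y z) (w z)) (triple_fields a b c))) ->
  cvg_loc_unif U f f0.
Proof.
move=> oU cx cw cy Uyxw fE f0E.
have [_ cvg_cl] := cluster_term_cvg u a b c.
pose Phi z := (pair_conf (x z) (w z), pair_conf (y z) 0).
have cPhi : continuous Phi.
  have c0 : continuous (fun _ : 'M[R]_(1 + 1, d) => 0 : 'rV[R]_d).
    exact: cst_continuous.
  have c1 : continuous (fun t => pair_conf (x t) (w t)).
    exact: continuous_pair_conf.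
  have c2 : continuous (fun t => pair_conf (y t) 0).
    exact: continuous_pair_conf.
  by move=> z; exact: (cvg_pair (c1 z) (c2 z)).
apply: (cvg_loc_unif_pullback (Phi := Phi) oU cPhi _ fE _ cvg_cl).
- by move=> z /Uyxw; exact: cluster_dom_pair.
- by move=> z Uz; rewrite f0E // cluster_conf_pair.
Qed.

Lemma product_cvg_loc_unif u a b c (x1 x2 : 'M[R]_(1 + 1, d) -> 'rV[R]_d) f0 :
  continuous x1 -> continuous x2 ->
  let U := [set z | 0 < enorm (x2 z) < enorm (x1 z)] in
  (forall z, U z -> f0 z = pairing u
    (corr S (triple_conf (x1 z) (x2 z) 0) (triple_fields a b c))) ->
  cvg_loc_unif U (fun D z => product_term Y u a b c D (x1 z) (x2 z)) f0.
Proof.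
move=> cx1 cx2 U f0E.
have c0 : continuous (fun _ : 'M[R]_(1 + 1, d) => 0 : 'rV[R]_d).
  exact: cst_continuous.
apply: (cluster_cvg_loc_unif (u := u) (a := a) (b := b) (c := c)
    (open_annulus cx2 cx1) cx1 c0 cx2) => [z|D z|z Uz].
- by rewrite subr0.
- move=> /andP[x20 x2lt]; have x10 := lt_trans x20 x2lt.
  by rewrite !enorm_gt0 in x20 x10; exact: product_termE.
- by rewrite add0r; exact: f0E.
Qed.

Lemma iterate_cvg_loc_unif u a b c (x0 x2 : 'M[R]_(1 + 1, d) -> 'rV[R]_d) f0 :
  continuous x0 -> continuous x2 ->
  let U := [set z | 0 < enorm (x0 z) < enorm (x2 z)] in
  (forall z, U z -> f0 z = pairing u (corr S
    (triple_conf 0 (x2 z + x0 z) (x2 z)) (triple_fields c a b))) ->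
  cvg_loc_unif U (fun D z => iterate_term Y u a b c D (x0 z) (x2 z)) f0.
Proof.
move=> cx0 cx2 U f0E.
have c0 : continuous (fun _ : 'M[R]_(1 + 1, d) => 0 : 'rV[R]_d).
  exact: cst_continuous.
apply: (cluster_cvg_loc_unif (u := u) (a := c) (b := a) (c := b)
    (open_annulus cx0 cx2) c0 cx2 cx0) => [z|D z|//].
- by rewrite sub0r enormN.
- move=> /andP[x00 x0lt]; have x20 := lt_trans x00 x0lt.
  by rewrite !enorm_gt0 in x00 x20; exact: iterate_termE.
Qed.

End Convergence.

Theorem proposition2p10 (R : realType) (d : nat) (hd : (2 <= d)%N)
    (H : lmodType R[i]) (S : cc_system d H)
    (Y : H -> H -> sph_mon R d -> H) (hY : is_vertex_operator S Y)
    (u0 : Hdual S) (a1 a2 a3 : H) :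
  (forall x1 x2 : 'rV[R]_d, 0 < enorm x2 < enorm x1 ->
     abs_summable (fun D : R => product_term Y u0 a1 a2 a3 D x1 x2)) /\
  (forall x0 x2 : 'rV[R]_d, 0 < enorm x0 < enorm x2 ->
     abs_summable (fun D : R => iterate_term Y u0 a1 a2 a3 D x0 x2)) /\
  exists phi : 'M[R]_(1 + 1, d) -> R[i]^o,
    [/\ analytic_on (@Y2 R d) phi,
        cvg_loc_unif
          [set z : 'M[R]_(1 + 1, d) |
             0 < enorm (dsubmx z) < enorm (usubmx z)]
          (fun D z => product_term Y u0 a1 a2 a3 D (usubmx z) (dsubmx z)) phi,
        cvg_loc_unif
          [set z : 'M[R]_(1 + 1, d) |
             0 < enorm (usubmx z) < enorm (dsubmx z)]
          (fun D z => product_term Y u0 a2 a1 a3 D (dsubmx z) (usubmx z)) phi &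
        cvg_loc_unif
          [set z : 'M[R]_(1 + 1, d) |
             0 < enorm (usubmx z - dsubmx z) < enorm (dsubmx z)]
          (fun D z => iterate_term Y u0 a1 a2 a3 D
             (usubmx z - dsubmx z) (dsubmx z)) phi].
Proof.
split; first by move=> x1 x2; exact: product_summable.
split; first by move=> x0 x2; exact: iterate_summable.
have cu := @continuous_usubmx R d; have cd := @continuous_dsubmx R d.
have neq (x y : 'rV[R]_d) : enorm x < enorm y -> x != y.
  by apply: contraTneq => ->; rewrite ltxx.
exists (three_point u0 a1 a2 a3); split.
- exact: three_point_analytic.
- exact: product_cvg_loc_unif.
- apply: product_cvg_loc_unif => // z /andP[z1 z12].
  rewrite -corr_triple_swap12 //; apply: conf_triple.
  + exact: neq.
  + by rewrite -enorm_gt0.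
  + by rewrite -enorm_gt0 (lt_trans z1).
- have cud : continuous (fun z : 'M[R]_(1 + 1, d) => usubmx z - dsubmx z).
    by move=> z; exact: (cvgB (cu z) (cd z)).
  apply: iterate_cvg_loc_unif => // z /andP[z12 lt2].
  (* the limit is the three-point function at (0, x1, x2), and two exchanges of
     neighbours move the origin to the last place *)
  rewrite addrC subrK; have z2 := lt_trans z12 lt2.
  rewrite enorm_gt0 in z2; rewrite enorm_gt0 subr_eq0 in z12.
  have z1 : usubmx z != 0.
    by apply: contraTneq lt2 => ->; rewrite sub0r enormN ltxx.
  have c012 : conf (triple_conf 0 (usubmx z) (dsubmx z)).
    by apply: conf_triple; rewrite // eq_sym.
  rewrite corr_triple_swap12 // corr_triple_swap23 //.
  by apply: conf_triple; rewrite // eq_sym.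
Qed.
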